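(* Let $\mathsf{V}$ be a Hamiltonian variety of pointed residuated lattices. Then $\mathrm{Th}(\mathsf{V})$ has a model completion if, and only if, $\mathsf{V}$ is coherent and has equationally definable principal congruences, the amalgamation property, and the equational variable restriction property.
   Context: A pointed residuated lattice is an algebra $\langle A,\wedge,\vee,\cdot,\backslash,/,\mathrm{e},0\rangle$ such that $\langle A,\wedge,\vee\rangle$ is a lattice, $\langle A,\cdot,\mathrm{e}\rangle$ is a monoid, $0$ is a constant, and for all $a,b,c$: $b\le a\backslash c\iff a\cdot b\le c\iff a\le c/b$. Powers: $a^0=\mathrm{e}$, $a^{n+1}=a\cdot a^n$. A variety $\mathsf{V}$ of pointed residuated lattices is Hamiltonian if for some integer $k\ge1$, $\mathsf{V}\models(x\wedge\mathrm{e})^k\cdot y\approx y\cdot(x\wedge\mathrm{e})^k$. A model completion of a theory $T$ is a model complete theory $T^*$ with the same universal consequences as $T$ such that for every model $M$ of $T$, $T^*$ plus the diagram of $M$ is complete. $\mathsf{V}$ is coherent if every finitely generated subalgebra of a finitely presented member of $\mathsf{V}$ is finitely presented. $\mathsf{V}$ has equationally definable principal congruences if there is a conjunction of equations $\alpha(x_1,x_2,y_1,y_2)$ such that for all $\mathbf{A}\in\mathsf{V}$, $a_1,a_2,b_1,b_2\in A$: $(a_1,a_2)$ lies in the congruence generated by $(b_1,b_2)$ iff $\mathbf{A}\models\alpha(a_1,a_2,b_1,b_2)$. Amalgamation property: for $\mathbf{A},\mathbf{B},\mathbf{C}\in\mathsf{V}$ and embeddings $f\colon\mathbf{A}\to\mathbf{B}$,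 $g\colon\mathbf{A}\to\mathbf{C}$, there are $\mathbf{D}\in\mathsf{V}$ and embeddings $h,k$ of $\mathbf{B},\mathbf{C}$ into $\mathbf{D}$ with $hf=kg$. Equational variable restriction property: for any finite set of variables $\overline{x}$, variable $y\notin\overline{x}$ and conjunction of equations $\gamma(\overline{x},y)$, there is a formula $\pi(\overline{x})$ that is either $\bot$ (false) or a conjunction of equations such that $\mathsf{V}\models\pi\to\gamma$ and for every conjunction of equations $\varphi(\overline{x})$, $\mathsf{V}\models\varphi\to\gamma$ implies $\mathsf{V}\models\varphi\to\pi$ (here $\mathsf{V}\models\alpha$ means validity in all members under all assignments). *)

(* Defs.v *)
From mathcomp Require Import all_boot.
From Stdlib Require List.
Set Implicit Arguments. Unset Strict Implicit. Unset Printing Implicit Defensive.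

Inductive term : Type :=
| tvar  : nat -> term
| tmeet : term -> term -> term
| tjoin : term -> term -> term
| tmul  : term -> term -> term
| tldiv : term -> term -> term
| trdiv : term -> term -> term
| tone  : term
| tzero : term.

Fixpoint tpow (t : term) (n : nat) : term :=
  match n with 0 => tone | S n => tmul t (tpow t n) end.

Fixpoint tvars (t : term) : seq nat :=
  match t with
  | tvar i => [:: i]
  | tmeet u v | tjoin u v | tmul u v | tldiv u v | trdiv u v => tvars u ++ tvars v
  | tone | tzero => [::]
  end.

Record struct : Type := Struct {
  carrier :> Type;
  s_meet : carrier -> carrier -> carrier;
  s_join : carrier -> carrier -> carrier;
  s_mul  : carrier -> carrier -> carrier;
  s_ldiv : carrier -> carrier -> carrier;
  s_rdiv : carrier -> carrier -> carrier;
  s_one  : carrier;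
  s_zero : carrier }.
Arguments s_meet {s}. Arguments s_join {s}. Arguments s_mul {s}.
Arguments s_ldiv {s}. Arguments s_rdiv {s}.
Arguments s_one s. Arguments s_zero s.

Fixpoint eval (A : struct) (a : nat -> A) (t : term) : A :=
  match t with
  | tvar i => a i
  | tmeet u v => s_meet (eval a u) (eval a v)
  | tjoin u v => s_join (eval a u) (eval a v)
  | tmul u v => s_mul (eval a u) (eval a v)
  | tldiv u v => s_ldiv (eval a u) (eval a v)
  | trdiv u v => s_rdiv (eval a u) (eval a v)
  | tone => s_one A
  | tzero => s_zero A
  end.

Definition eqn := (term * term)%type.
Definition holds (A : struct) (a : nat -> A) (e : eqn) : Prop := eval a e.1 = eval a e.2.
Definition holds_all (A : struct) (a : nat -> A) (E : list eqn) : Prop :=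
  forall e, List.In e E -> holds a e.
Definition eqns_vars_in (P : nat -> bool) (E : list eqn) : Prop :=
  forall e, List.In e E -> all P (tvars e.1) && all P (tvars e.2).

Definition le (A : struct) (x y : A) : Prop := s_meet x y = x.

Definition is_prl (A : struct) : Prop :=
  (forall x y : A, s_meet x y = s_meet y x) /\
  (forall x y : A, s_join x y = s_join y x) /\
  (forall x y z : A, s_meet x (s_meet y z) = s_meet (s_meet x y) z) /\
  (forall x y z : A, s_join x (s_join y z) = s_join (s_join x y) z) /\
  (forall x y : A, s_meet x (s_join x y) = x) /\
  (forall x y : A, s_join x (s_meet x y) = x) /\
  (forall x y z : A, s_mul x (s_mul y z) = s_mul (s_mul x y) z) /\
  (forall x : A, s_mul (s_one A) x = x) /\
  (forall x : A, s_mul x (s_one A) = x) /\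
  (forall a b c : A, (le b (s_ldiv a c) <-> le (s_mul a b) c) /\
                     (le (s_mul a b) c <-> le a (s_rdiv c b))).

Definition variety (V : struct -> Prop) : Prop :=
  exists E : eqn -> Prop, forall A : struct,
    V A <-> (is_prl A /\ forall e, E e -> forall a : nat -> A, holds a e).

Definition hamiltonian (V : struct -> Prop) : Prop :=
  exists k : nat, (1 <= k)%N /\
    forall A, V A -> forall a : nat -> A,
      holds a (tmul (tpow (tmeet (tvar 0) tone) k) (tvar 1),
               tmul (tvar 1) (tpow (tmeet (tvar 0) tone) k)).

Definition is_hom (A B : struct) (h : A -> B) : Prop :=
  (forall x y, h (s_meet x y) = s_meet (h x) (h y)) /\
  (forall x y, h (s_join x y) = s_join (h x) (h y)) /\
  (forall x y, h (s_mul x y) = s_mul (h x) (h y)) /\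
  (forall x y, h (s_ldiv x y) = s_ldiv (h x) (h y)) /\
  (forall x y, h (s_rdiv x y) = s_rdiv (h x) (h y)) /\
  h (s_one A) = s_one B /\ h (s_zero A) = s_zero B.

Definition embedding (A B : struct) (h : A -> B) : Prop :=
  is_hom h /\ (forall x y, h x = h y -> x = y).

Inductive form : Type :=
| fbot : form
| feq  : term -> term -> form
| fneg : form -> form
| fand : form -> form -> form
| for_ : form -> form -> form
| fimp : form -> form -> form
| fall : nat -> form -> form
| fex  : nat -> form -> form.

Definition upd (A : Type) (a : nat -> A) (n : nat) (x : A) : nat -> A :=
  fun m => if m == n then x else a m.

Fixpoint sat (A : struct) (a : nat -> A) (f : form) : Prop :=
  match f with
  | fbot => False
  | feq u v => eval a u = eval a v
  | fneg g => ~ sat a g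
  | fand g h => sat a g /\ sat a h
  | for_ g h => sat a g \/ sat a h
  | fimp g h => sat a g -> sat a h
  | fall n g => forall x : A, sat (upd a n x) g
  | fex n g => exists x : A, sat (upd a n x) g
  end.

Fixpoint fv (f : form) : seq nat :=
  match f with
  | fbot => [::]
  | feq u v => tvars u ++ tvars v
  | fneg g => fv g
  | fand g h | for_ g h | fimp g h => fv g ++ fv h
  | fall n g | fex n g => filter (fun m => m != n) (fv g)
  end.

Definition sentence (f : form) : Prop := fv f = [::].

Fixpoint qfree (f : form) : bool :=
  match f with
  | fbot | feq _ _ => true
  | fneg g => qfree g
  | fand g h | for_ g h | fimp g h => qfree g && qfree h
  | fall _ _ | fex _ _ => false
  end.

Fixpoint universal (f : form) : bool :=
  match f with
  | fall _ g => universal g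
  | g => qfree g
  end.

Definition theory := form -> Prop.

Definition model (T : theory) (M : struct) : Prop :=
  forall f, T f -> forall a : nat -> M, sat a f.

Definition consequence (T : theory) (f : form) : Prop :=
  forall M : struct, model T M -> forall a : nat -> M, sat a f.

Definition ThV (V : struct -> Prop) : theory :=
  fun f => sentence f /\ forall A, V A -> forall a : nat -> A, sat a f.

Definition elementary (A B : struct) (h : A -> B) : Prop :=
  forall (f : form) (a : nat -> A), sat a f <-> sat (fun i => h (a i)) f.

Definition model_complete (T : theory) : Prop :=
  forall M N : struct, model T M -> model T N ->
    forall h : M -> N, embedding h -> elementary h.

(** T together with the (atomic) diagram of M is complete: the models of
    T + diag(M) are exactly the models N of T together with an embedding
    M -> N interpreting the new constants; a sentence of L(M) is a formula
    f with its free variables instantiated by an assignment a into M. *)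
Definition diagram_complete (T : theory) (M : struct) : Prop :=
  forall (f : form) (a : nat -> M),
    (forall N : struct, model T N -> forall h : M -> N, embedding h ->
        sat (fun i => h (a i)) f) \/
    (forall N : struct, model T N -> forall h : M -> N, embedding h ->
        sat (fun i => h (a i)) (fneg f)).

Definition model_completion (T Ts : theory) : Prop :=
  (forall f, Ts f -> sentence f) /\
  model_complete Ts /\
  (forall f, sentence f -> universal f -> (consequence T f <-> consequence Ts f)) /\
  (forall M : struct, model T M -> diagram_complete Ts M).

Definition has_model_completion (T : theory) : Prop :=
  exists Ts : theory, model_completion T Ts.

Definition fin_presented (V : struct -> Prop) (A : struct) : Prop :=
  V A /\ exists (n : nat) (g : nat -> A) (R : list eqn),
    (forall x : A, exists t, all (fun i => (i < n)%N) (tvars t) /\ x = eval g t) /\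
    eqns_vars_in (fun i => (i < n)%N) R /\
    holds_all g R /\
    (forall B : struct, V B -> forall d : nat -> B, holds_all d R ->
       exists h : A -> B, is_hom h /\ forall i, (i < n)%N -> h (g i) = d i).

Definition gen_pred (A : struct) (m : nat) (b : nat -> A) (x : A) : Prop :=
  exists t, all (fun i => (i < m)%N) (tvars t) /\ x = eval b t.

Section GenSub.
Variables (A : struct) (m : nat) (b : nat -> A).
Definition gtype := {x : A | gen_pred m b x}.

Lemma gen_bin (op : A -> A -> A) (top : term -> term -> term) :
  (forall u v, eval b (top u v) = op (eval b u) (eval b v)) ->
  (forall u v, tvars (top u v) = tvars u ++ tvars v) ->
  forall x y, gen_pred m b x -> gen_pred m b y -> gen_pred m b (op x y).
Proof.
move=> He Hv x y [u [Hu ->]] [v [Hv' ->]]; exists (top u v).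
by rewrite He Hv all_cat Hu Hv'.
Qed.

Definition gbin op top He Hv (x y : gtype) : gtype :=
  exist _ (op (proj1_sig x) (proj1_sig y))
    (@gen_bin op top He Hv _ _ (proj2_sig x) (proj2_sig y)).

Lemma gen_cst (t : term) : tvars t = [::] -> gen_pred m b (eval b t).
Proof. by move=> Ht; exists t; rewrite Ht. Qed.

Definition gen_sub : struct :=
  @Struct gtype
    (@gbin s_meet tmeet (fun _ _ => erefl) (fun _ _ => erefl))
    (@gbin s_join tjoin (fun _ _ => erefl) (fun _ _ => erefl))
    (@gbin s_mul tmul (fun _ _ => erefl) (fun _ _ => erefl))
    (@gbin s_ldiv tldiv (fun _ _ => erefl) (fun _ _ => erefl))
    (@gbin s_rdiv trdiv (fun _ _ => erefl) (fun _ _ => erefl))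
    (exist _ (s_one A) (@gen_cst tone erefl))
    (exist _ (s_zero A) (@gen_cst tzero erefl)).
End GenSub.

Definition coherent (V : struct -> Prop) : Prop :=
  forall A : struct, fin_presented V A ->
    forall (m : nat) (b : nat -> A), fin_presented V (gen_sub m b).

Definition congruence (A : struct) (th : A -> A -> Prop) : Prop :=
  (forall x, th x x) /\ (forall x y, th x y -> th y x) /\
  (forall x y z, th x y -> th y z -> th x z) /\
  (forall op : A -> A -> A,
     (op = s_meet \/ op = s_join \/ op = s_mul \/ op = s_ldiv \/ op = s_rdiv) ->
     forall x x' y y', th x x' -> th y y' -> th (op x y) (op x' y')).

Definition Cg (A : struct) (b1 b2 : A) (x y : A) : Prop :=
  forall th, congruence th -> th b1 b2 -> th x y.

Definition asg4 (A : Type) (a1 a2 b1 b2 : A) (i : nat) : A :=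
  match i with 0 => a1 | 1 => a2 | 2 => b1 | 3 => b2 | _ => a1 end.

Definition EDPC (V : struct -> Prop) : Prop :=
  exists alpha : list eqn, eqns_vars_in (fun i => (i < 4)%N) alpha /\
    forall A, V A -> forall a1 a2 b1 b2 : A,
      Cg b1 b2 a1 a2 <-> holds_all (asg4 a1 a2 b1 b2) alpha.

Definition AP (V : struct -> Prop) : Prop :=
  forall A B C : struct, V A -> V B -> V C ->
  forall (f : A -> B) (g : A -> C), embedding f -> embedding g ->
  exists (D : struct) (h : B -> D) (k : C -> D),
    V D /\ embedding h /\ embedding k /\ forall x, h (f x) = k (g x).

Definition holds_opt (A : struct) (a : nat -> A) (pi : option (list eqn)) : Prop :=
  match pi with None => False | Some E => holds_all a E end.

Definition ERVP (V : struct -> Prop) : Prop :=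
  forall (xs : seq nat) (y : nat) (gam : list eqn),
    y \notin xs -> eqns_vars_in (fun i => i \in y :: xs) gam ->
    exists pi : option (list eqn),
      (forall E, pi = Some E -> eqns_vars_in (fun i => i \in xs) E) /\
      (forall A, V A -> forall a : nat -> A, holds_opt a pi -> holds_all a gam) /\
      (forall phi : list eqn, eqns_vars_in (fun i => i \in xs) phi ->
         (forall A, V A -> forall a : nat -> A, holds_all a phi -> holds_all a gam) ->
         (forall A, V A -> forall a : nat -> A, holds_all a phi -> holds_opt a pi)).

(* Main.v *)
(* Residuation is equational, so V is closed under substructures, products and
   quotients, and the models of Th(V) are exactly the members of V.

   Sufficiency.  It is enough to find, for every system gamma(x,y) of equations
   and delta_j(x,y) of negated equations, a quantifier-free chi(x) that holds at
   a in A iff some extension of A in V contains a solution y: adding the axioms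
   chi -> exists y (...) to Th(V) eliminates quantifiers, and every member of V
   embeds in a model of them by a chain construction.  Iterating EDPC turns
   "gamma implies delta_j" into a system of equations theta_j(x,y), and also gives
   the congruence extension property.  Coherence yields the equations Pi(x) implied
   by gamma; with congruence extension and amalgamation, Pi(a) is sufficient for
   gamma(a,y) to be solvable in an extension.  If pi_j(x) is the restriction of
   theta_j provided by the equational variable restriction property, then
   chi = Pi /\ not pi_1 /\ ... /\ not pi_n.

   Necessity.  Amalgamation holds because extensions of A to models of the
   completion are elementarily equivalent over A.  For coherence, a quantifier-free
   condition forcing "z_i = t_i(x) for some x satisfying R" has a positive part that
   presents the subalgebra.  In the Hamiltonian case the congruence generated
   by (u,1), with u <= 1, contains (v,1), with v <= 1, iff u^m <= v for some m;
   in models of the completion this is equivalent to a first-order condition, so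
   compactness bounds m, which is EDPC.  Compactness also gives finitely many
   systems sigma_1(x), ..., sigma_k(x) implying gamma(x,y) such that every system in
   x that implies gamma implies one of them; writing sigma_i as u_i = 1 with
   u_i <= 1, the equation u_1 \/ ... \/ u_k = 1 still implies gamma, because
   u \/ v = 1 entails u^m \/ v^n = 1. *)
From mathcomp Require Import all_boot.
From mathcomp Require Import boolp classical_sets filter.
From Stdlib Require List.
Require Import Defs.
Set Implicit Arguments. Unset Strict Implicit. Unset Printing Implicit Defensive.

(** * Substitution and homomorphisms *)

Fixpoint tsub (s : nat -> term) (t : term) : term :=
  match t with
  | tvar i => s i
  | tmeet u v => tmeet (tsub s u) (tsub s v)
  | tjoin u v => tjoin (tsub s u) (tsub s v)
  | tmul u v => tmul (tsub s u) (tsub s v)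
  | tldiv u v => tldiv (tsub s u) (tsub s v)
  | trdiv u v => trdiv (tsub s u) (tsub s v)
  | tone => tone
  | tzero => tzero
  end.

Definition esub (s : nat -> term) (e : eqn) : eqn := (tsub s e.1, tsub s e.2).
Definition evars (e : eqn) : seq nat := tvars e.1 ++ tvars e.2.

Lemma eval_tsub (A : struct) (a : nat -> A) s t :
  eval a (tsub s t) = eval (fun i => eval a (s i)) t.
Proof. by elim: t => //= u -> v ->. Qed.

Lemma holds_esub (A : struct) (a : nat -> A) s e :
  holds a (esub s e) <-> holds (fun i => eval a (s i)) e.
Proof. by rewrite /holds /= !eval_tsub. Qed.

Lemma holds_all_esub (A : struct) (a : nat -> A) s E :
  holds_all a (List.map (esub s) E) <-> holds_all (fun i => eval a (s i)) E.
Proof.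
split=> H e He.
  by apply/holds_esub/H/List.in_map.
by case/List.in_map_iff: He => e' [<- He']; apply/holds_esub/H.
Qed.

Lemma holds_all_app (A : struct) (a : nat -> A) E F :
  holds_all a (E ++ F)%list <-> holds_all a E /\ holds_all a F.
Proof.
split=> [H|[HE HF] e /List.in_app_iff[]]; [|exact: HE|exact: HF].
by split=> e He; apply: H; apply/List.in_app_iff; [left|right].
Qed.

Lemma holds_all_cons (A : struct) (a : nat -> A) e E :
  holds_all a (e :: E) <-> holds a e /\ holds_all a E.
Proof.
split=> [H|[He HE] e' [<- //|]]; last exact: HE.
by split=> [|e' He']; apply: H; [left|right].
Qed.

Lemma tvars_tsub (P : pred nat) s t :
  all P (tvars (tsub s t)) = all (fun i => all P (tvars (s i))) (tvars t).
Proof. by elim: t => //= [i|u IH v IH'|u IH v IH'|u IH v IH'|u IH v IH'|u IH v IH'];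
  rewrite ?andbT // !all_cat IH IH'. Qed.

Lemma evars_esub (P : pred nat) s e :
  all P (evars (esub s e)) = all (fun i => all P (tvars (s i))) (evars e).
Proof. by rewrite !all_cat !tvars_tsub. Qed.

Lemma eqns_vars_inP (P : pred nat) E :
  eqns_vars_in P E <-> forall e, List.In e E -> all P (evars e).
Proof. by split=> H e /H; rewrite all_cat. Qed.

Lemma eqns_vars_in_app (P : pred nat) E F :
  eqns_vars_in P (E ++ F)%list <-> eqns_vars_in P E /\ eqns_vars_in P F.
Proof.
split=> [H|[HE HF] e /List.in_app_iff[]]; [|exact: HE|exact: HF].
by split=> e He; apply: H; apply/List.in_app_iff; [left|right].
Qed.

Lemma eqns_vars_in_cons (P : pred nat) e E :
  eqns_vars_in P (e :: E) <-> all P (evars e) /\ eqns_vars_in P E.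
Proof.
split=> [H|[He HE] e' [<-|]]; [|by rewrite -all_cat|exact: HE].
by split=> [|e' He']; [rewrite all_cat|]; apply: H; [left|right].
Qed.

Lemma eqns_vars_in_esub (P Q : pred nat) s E :
  eqns_vars_in P E -> (forall i, P i -> all Q (tvars (s i))) ->
  eqns_vars_in Q (List.map (esub s) E).
Proof.
move=> /eqns_vars_inP HE Hs; apply/eqns_vars_inP => e /List.in_map_iff[e' [<- /HE H]].
by rewrite evars_esub; apply: sub_all H.
Qed.

Lemma eqns_vars_in_sub (P Q : pred nat) E :
  eqns_vars_in P E -> (forall i, P i -> Q i) -> eqns_vars_in Q E.
Proof.
move=> /eqns_vars_inP HE PQ; apply/eqns_vars_inP => e /HE; exact: sub_all.
Qed.

Lemma ltn_bound (s : seq nat) : exists n, all (fun i => i < n) s.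
Proof.
elim: s => [|i s [n Hn]]; first by exists 0.
exists (maxn i.+1 n); rewrite /= leq_maxl /=; apply: sub_all Hn => j Hj.
by rewrite leq_max Hj orbT.
Qed.

Lemma eqns_bound (E : list eqn) : exists n, eqns_vars_in (fun i => i < n) E.
Proof.
elim: E => [|e E [n Hn]]; first by exists 0.
have [m Hm] := ltn_bound (evars e); exists (maxn m n); apply/eqns_vars_in_cons; split.
  by apply: sub_all Hm => j Hj; rewrite leq_max Hj.
by apply: eqns_vars_in_sub Hn _ => j Hj; rewrite leq_max Hj orbT.
Qed.

Lemma eq_eval (P : pred nat) (A : struct) (a b : nat -> A) t :
  all P (tvars t) -> (forall i, P i -> a i = b i) -> eval a t = eval b t.
Proof.
move=> Ht Hab; elim: t Ht => //= [i|u IH v IH'|u IH v IH'|u IH v IH'|u IH v IH'|u IH v IH'];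
  rewrite ?andbT ?all_cat; first exact: Hab.
all: by case/andP=> /IH -> /IH' ->.
Qed.

Lemma eq_holds (P : pred nat) (A : struct) (a b : nat -> A) e :
  all P (evars e) -> (forall i, P i -> a i = b i) -> holds a e -> holds b e.
Proof.
rewrite all_cat /holds => /andP[H1 H2] Hab.
by rewrite (eq_eval H1 Hab) (eq_eval H2 Hab).
Qed.

Lemma eq_holds_all (P : pred nat) (A : struct) (a b : nat -> A) E :
  eqns_vars_in P E -> (forall i, P i -> a i = b i) -> holds_all a E -> holds_all b E.
Proof. by move=> /eqns_vars_inP HE Hab H e He; apply: eq_holds (HE e He) Hab (H e He). Qed.

Lemma eval_hom (A B : struct) (h : A -> B) (a : nat -> A) t :
  is_hom h -> h (eval a t) = eval (fun i => h (a i)) t.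
Proof.
by move=> [hm [hj [hu [hl [hr [h1 h0]]]]]]; elim: t => //= u IH v IH'; rewrite -IH -IH'.
Qed.

Lemma holds_hom (A B : struct) (h : A -> B) (a : nat -> A) e :
  is_hom h -> holds a e -> holds (fun i => h (a i)) e.
Proof. by move=> Hh; rewrite /holds -!(eval_hom _ _ Hh) => ->. Qed.

Lemma holds_all_hom (A B : struct) (h : A -> B) (a : nat -> A) E :
  is_hom h -> holds_all a E -> holds_all (fun i => h (a i)) E.
Proof. by move=> Hh H e /H; apply: holds_hom. Qed.

Lemma holds_emb (A B : struct) (h : A -> B) (a : nat -> A) e :
  embedding h -> holds (fun i => h (a i)) e <-> holds a e.
Proof.
move=> [Hh inj]; split; last exact: holds_hom.
by rewrite /holds -!(eval_hom _ _ Hh) => /inj.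
Qed.

Lemma holds_all_emb (A B : struct) (h : A -> B) (a : nat -> A) E :
  embedding h -> holds_all (fun i => h (a i)) E <-> holds_all a E.
Proof. by move=> Hh; split=> H e He; apply/(holds_emb a e Hh)/H. Qed.

Lemma id_emb (A : struct) : embedding (@id A).
Proof. by []. Qed.

Lemma hom_comp (A B C : struct) (h : A -> B) (k : B -> C) :
  is_hom h -> is_hom k -> is_hom (fun x => k (h x)).
Proof.
move=> [h1 [h2 [h3 [h4 [h5 [h6 h7]]]]]] [k1 [k2 [k3 [k4 [k5 [k6 k7]]]]]].
by do 6?split=> *; congruence.
Qed.

Lemma emb_comp (A B C : struct) (h : A -> B) (k : B -> C) :
  embedding h -> embedding k -> embedding (fun x => k (h x)).
Proof.
move=> [hh hi] [kh ki]; split; first exact: hom_comp.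
by move=> x y /ki /hi.
Qed.

Lemma emb_of_comp (A B C : struct) (h : A -> B) (k : B -> C) (l : A -> C) :
  is_hom h -> embedding l -> (forall x, k (h x) = l x) -> embedding h.
Proof.
move=> hh [_ li] Hl; split=> // x y hxy.
by apply: li; rewrite -!Hl hxy.
Qed.

(** * Products and quotients of structures *)

Definition prod_struct (I : Type) (A : I -> struct) : struct :=
  @Struct (forall i, A i)
    (fun x y i => s_meet (x i) (y i)) (fun x y i => s_join (x i) (y i))
    (fun x y i => s_mul (x i) (y i)) (fun x y i => s_ldiv (x i) (y i))
    (fun x y i => s_rdiv (x i) (y i)) (fun i => s_one (A i)) (fun i => s_zero (A i)).

Lemma proj_hom I (A : I -> struct) i : is_hom (fun x : prod_struct A => x i).
Proof. by []. Qed.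

Lemma eval_prod I (A : I -> struct) (a : nat -> prod_struct A) t i :
  eval a t i = eval (fun n => a n i) t.
Proof. exact: (eval_hom a t (proj_hom A i)). Qed.

Lemma holds_prod I (A : I -> struct) (a : nat -> prod_struct A) e :
  holds a e <-> forall i, holds (fun n => a n i) e.
Proof.
split=> [H i|H]; first exact: (holds_hom (proj_hom A i) H).
by apply: functional_extensionality_dep => i; rewrite !eval_prod; apply: H.
Qed.

Lemma pairing_hom I (A : I -> struct) (B : struct) (h : forall i, B -> A i) :
  (forall i, is_hom (h i)) -> is_hom (fun x => (fun i => h i x) : prod_struct A).
Proof.
move=> Hh; do 6?split=> *; apply: functional_extensionality_dep => i /=;
  by case: (Hh i) => [h1 [h2 [h3 [h4 [h5 [h6 h7]]]]]].
Qed.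

Lemma pairing_emb I (A : I -> struct) (B : struct) (h : forall i, B -> A i) (i0 : I) :
  (forall i, is_hom (h i)) -> embedding (h i0) ->
  embedding (fun x => (fun i => h i x) : prod_struct A).
Proof.
move=> Hh Hi0.
exact: (@emb_of_comp _ (prod_struct A) (A i0) _ (fun x => x i0) (h i0) (pairing_hom Hh)).
Qed.

Section Quotient.
Variables (A : struct) (th : A -> A -> Prop).

(** Classes are carried by chosen representatives. The choice depends only on the predicate [th x],
    so congruent elements get the same representative by extensionality. *)
Definition crep (x : A) : A :=
  if pselect (exists y, th x y) is left h then sval (cid h) else s_one A.

Definition quot_carrier := {x : A | crep x = x}.

Hypothesis Hth : congruence th.

Lemma crepP x : th x (crep x).
Proof.
rewrite /crep; case: pselect => [h|[]]; first by case: cid.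
by exists x; apply: Hth.1.
Qed.

Lemma eq_crep x y : th x y <-> crep x = crep y.
Proof.
have [r [s [t _]]] := Hth; split=> [xy|e].
  rewrite /crep; suff -> : th x = th y by [].
  by apply/predeqP => z; split; apply: t => //; apply: s.
by apply: t (crepP x) _; rewrite e; apply/s/crepP.
Qed.

Lemma crepK x : crep (crep x) = crep x.
Proof. by apply/esym/eq_crep/crepP. Qed.

Definition qelt (x : A) : quot_carrier :=
  exist _ (crep x) (crepK x).

Definition quot : struct :=
  @Struct quot_carrier
   (fun x y => qelt (s_meet (sval x) (sval y))) (fun x y => qelt (s_join (sval x) (sval y)))
   (fun x y => qelt (s_mul (sval x) (sval y))) (fun x y => qelt (s_ldiv (sval x) (sval y)))
   (fun x y => qelt (s_rdiv (sval x) (sval y))) (qelt (s_one A)) (qelt (s_zero A)).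

Definition qcl (x : A) : quot := qelt x.

Lemma qclE x y : qcl x = qcl y <-> th x y.
Proof. by split=> [[] /eq_crep//|/eq_crep h]; apply: eq_exist. Qed.

Lemma qcl_sval (x : quot) : qcl (sval x) = x.
Proof. by case: x => x h; apply: eq_exist. Qed.

Lemma qcl_hom : is_hom (qcl : A -> quot).
Proof.
have [_ [s [_ c]]] := Hth.
by do 6?split=> // *; apply/qclE; apply: c; rewrite /=; intuition; exact: crepP.
Qed.

Lemma qcl_lift (a : nat -> quot) : exists a' : nat -> A, a = fun i => qcl (a' i).
Proof. by exists (fun i => sval (a i)); apply/funext => i; rewrite qcl_sval. Qed.

End Quotient.

Arguments qcl {A th} Hth x.

Lemma ker_congruence (A B : struct) (h : A -> B) :
  is_hom h -> congruence (fun x y => h x = h y).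
Proof.
move=> [h1 [h2 [h3 [h4 [h5 _]]]]]; split=> //; split=> [x y -> //|]; split=> [x y z -> //|].
by move=> op; intuition; subst op; congruence.
Qed.

Lemma Cg_congruence (A : struct) (b1 b2 : A) : congruence (Cg b1 b2).
Proof.
split=> [x th H _|]; first exact: H.1.
split=> [x y xy th H h|]; first by apply: H.2.1; apply: xy.
split=> [x y z xy yz th H h|op Hop x x' y y' xx yy th H h].
  by apply: (H.2.2.1 _ y); [apply: xy|apply: yz].
by apply: H.2.2.2 => //; [apply: xx|apply: yy].
Qed.

Lemma Cg_gen (A : struct) (b1 b2 : A) : Cg b1 b2 b1 b2.
Proof. by []. Qed.

(** Residuation gets no clause of its own here, so closure under substructures, products and
    quotients needs only the preservation of equations; [variety_eq_class] brings every variety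
    under this notion. *)
Definition eq_class (V : struct -> Prop) :=
  exists E : eqn -> Prop, forall A, V A <-> forall e, E e -> forall a : nat -> A, holds a e.

Lemma class_emb V (A B : struct) (h : A -> B) : eq_class V -> embedding h -> V B -> V A.
Proof.
move=> [E HE] Hh /HE HB; apply/HE => e /HB H a.
by apply/(holds_emb a e Hh)/H.
Qed.

Lemma class_prod V I (A : I -> struct) : eq_class V -> (forall i, V (A i)) -> V (prod_struct A).
Proof.
move=> [E HE] HA; apply/HE => e He a; apply/holds_prod => i.
by move/HE: (HA i); apply.
Qed.

Lemma class_quot V (A : struct) th (Hth : congruence th) : eq_class V -> V A -> V (@quot A th Hth).
Proof.
move=> [E HE] /HE HA; apply/HE => e He a; have [a' ->] := qcl_lift a.
by apply: (holds_hom (qcl_hom Hth)); apply: HA.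
Qed.

(** * Maps out of generated subalgebras *)

Lemma sub_emb (A : struct) m (b : nat -> A) : embedding (fun x : gen_sub m b => sval x).
Proof. by split=> // -[x hx] [y hy] /= e; apply: eq_exist. Qed.

Lemma class_sub V (A : struct) m (b : nat -> A) : eq_class V -> V A -> V (gen_sub m b).
Proof. by move=> HV; apply: class_emb (sub_emb m b). Qed.

Definition sub_el (A : struct) m (b : nat -> A) t (Ht : all (fun i => i < m) (tvars t)) : gen_sub m b :=
  exist _ (eval b t) (ex_intro _ t (conj Ht erefl)).

Lemma sub_elP (A : struct) m (b : nat -> A) (x : gen_sub m b) :
  exists t, exists Ht : all (fun i => i < m) (tvars t), x = sub_el b Ht.
Proof. by case: x => x [t [Ht e]]; exists t, Ht; apply: eq_exist. Qed.

Lemma sub_gens (A : struct) m (b : nat -> A) :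
  exists g : nat -> gen_sub m b, forall i, i < m -> sval (g i) = b i.
Proof.
have H i : exists x : gen_sub m b, i < m -> sval x = b i.
  case: (boolP (i < m)) => [Hi|]; last by exists (s_one _).
  have Ht : all (fun i => i < m) (tvars (tvar i)) by rewrite /= Hi.
  by exists (sub_el b Ht).
by have [g Hg] := choice H; exists g.
Qed.

(** Every element is named by a term, and the hypothesis makes the value at [d] independent of the
    term chosen. *)
Lemma sub_lift (A B : struct) m (b : nat -> A) (d : nat -> B) :
  (forall s t, all (fun i => i < m) (tvars s) -> all (fun i => i < m) (tvars t) ->
     eval b s = eval b t -> eval d s = eval d t) ->
  exists k : gen_sub m b -> B, is_hom k /\
    forall t, all (fun i => i < m) (tvars t) -> forall x, sval x = eval b t -> k x = eval d t.
Proof.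
move=> H.
have H' (x : gen_sub m b) : exists y, forall t, all (fun i => i < m) (tvars t) ->
    sval x = eval b t -> y = eval d t.
  have [t [Ht ->]] := sub_elP x.
  by exists (eval d t) => t' Ht' e; apply: H.
have [k Hk] := choice H'.
exists k; split; last by move=> t Ht x; apply: Hk.
have H2 (op : forall S : struct, S -> S -> S) top :
   (forall (S : struct) (a : nat -> S) s t, eval a (top s t) = op S (eval a s) (eval a t)) ->
   (forall s t, tvars (top s t) = tvars s ++ tvars t) ->
   (forall x y : gen_sub m b, sval (op _ x y) = op A (sval x) (sval y)) ->
   forall x y, k (op _ x y) = op _ (k x) (k y).
  move=> He Hv Hop x y; have [s [Hs ->]] := sub_elP x; have [t [Ht ->]] := sub_elP y.
  rewrite (Hk (sub_el b Hs) s) // (Hk (sub_el b Ht) t) // -He; apply: Hk; first by rewrite Hv all_cat Hs.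
  by rewrite Hop He.
split; first exact: (H2 (@s_meet) tmeet).
split; first exact: (H2 (@s_join) tjoin).
split; first exact: (H2 (@s_mul) tmul).
split; first exact: (H2 (@s_ldiv) tldiv).
split; first exact: (H2 (@s_rdiv) trdiv).
by split; [exact: (Hk _ tone)|exact: (Hk _ tzero)].
Qed.

Lemma sub_lift_emb (A B : struct) m (b : nat -> A) (d : nat -> B) :
  (forall s t, all (fun i => i < m) (tvars s) -> all (fun i => i < m) (tvars t) ->
     eval b s = eval b t <-> eval d s = eval d t) ->
  exists k : gen_sub m b -> B, embedding k /\
    forall t, all (fun i => i < m) (tvars t) -> forall x, sval x = eval b t -> k x = eval d t.
Proof.
move=> H; have [|k [Hk kE]] := @sub_lift A B m b d; first by move=> s t Hs Ht /H; apply.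
exists k; split=> //; split=> // x y.
have [s [Hs ->]] := sub_elP x; have [t [Ht ->]] := sub_elP y.
rewrite (kE s Hs (sub_el b Hs)) // (kE t Ht (sub_el b Ht)) // => /(H s t Hs Ht) e.
by apply: (sub_emb m b).2; apply: e.
Qed.

(** The last four equations encode residuation: x(y ∧ x\z) ≤ z and y ≤ x\(xy ∨ z), then their mirror
    images for right division. In each pair the first inequality yields one implication of the
    residuation law and the second its converse. *)
Definition resid_eqns : list eqn :=
  let x := tvar 0 in let y := tvar 1 in let z := tvar 2 in
  [:: (tmeet x y, tmeet y x); (tjoin x y, tjoin y x);
      (tmeet x (tmeet y z), tmeet (tmeet x y) z); (tjoin x (tjoin y z), tjoin (tjoin x y) z);
      (tmeet x (tjoin x y), x); (tjoin x (tmeet x y), x);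
      (tmul x (tmul y z), tmul (tmul x y) z); (tmul tone x, x); (tmul x tone, x);
      (tmeet (tmul x (tmeet y (tldiv x z))) z, tmul x (tmeet y (tldiv x z)));
      (tmeet y (tldiv x (tjoin (tmul x y) z)), y);
      (tmeet (tmul (tmeet x (trdiv z y)) y) z, tmul (tmeet x (trdiv z y)) y);
      (tmeet x (trdiv (tjoin (tmul x y) z) y), x)].

Lemma prl_eqnsP (A : struct) :
  is_prl A <-> forall e, List.In e resid_eqns -> forall a : nat -> A, holds a e.
Proof.
split.
  move=> [mC [jC [mA [jA [mj [jm [uA [u1l [u1r res]]]]]]]]].
  have lemr (x y : A) : le (s_meet x y) y.
    by rewrite /le -mA; congr s_meet; rewrite -{2}(jm y y) mj.
  have lejl (x y : A) : le x (s_join x y) by rewrite /le mj.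
  move=> e; do !case=> [<- a|]; rewrite /holds //=.
  - by apply: (proj1 (proj1 (res _ _ _))); apply: lemr.
  - by apply: (proj2 (proj1 (res _ _ _))); apply: lejl.
  - by apply: (proj2 (proj2 (res _ _ _))); apply: lemr.
  - by apply: (proj1 (proj2 (res _ _ _))); apply: lejl.
move=> H.
pose asg (x y z : A) i := nth z [:: x; y] i.
have E e : List.In e resid_eqns -> forall x y z, holds (asg x y z) e by move=> He *; apply: H.
have K n x y z : n < size resid_eqns -> holds (asg x y z) (nth (tone, tone) resid_eqns n).
  move=> Hn; apply: E; do 13?[case: n Hn => [_|n Hn]; first by rewrite /=; intuition].
  by [].
rewrite /holds /= in K.
have K0 x y := K 0 x y x isT. have K1 x y := K 1 x y x isT.
have K2 x y z := K 2 x y z isT. have K3 x y z := K 3 x y z isT.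
have K4 x y := K 4 x y x isT. have K5 x y := K 5 x y x isT.
have K6 x y z := K 6 x y z isT. have K7 x := K 7 x x x isT. have K8 x := K 8 x x x isT.
have K9 x y z := K 9 x y z isT. have K10 x y z := K 10 x y z isT.
have K11 x y z := K 11 x y z isT. have K12 x y z := K 12 x y z isT.
rewrite /asg /= in K0 K1 K2 K3 K4 K5 K6 K7 K8 K9 K10 K11 K12.
have ej (x y : A) : le x y -> s_join x y = y by rewrite /le => <-; rewrite K1 K0 K5.
do 9![split=> //]; move=> a b c; rewrite /le; split; split=> h.
- by rewrite -[in RHS]h -(K9 a b c) h.
- by rewrite -{2}(K10 a b c) (ej _ _ h).
- by rewrite -{2}(K12 a b c) (ej _ _ h).
- by rewrite -[in RHS]h -(K11 a b c) h.
Qed.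

Lemma variety_eq_class V : variety V -> eq_class V.
Proof.
move=> [E HE]; exists (fun e => E e \/ List.In e resid_eqns) => A.
rewrite HE prl_eqnsP; split=> [[H1 H2] e []|H]; [exact: H2|exact: H1|].
by split=> e He; apply: H; [right|left].
Qed.

(** * Formulas, ultraproducts and compactness *)

Lemma upd_same (A : Type) (a : nat -> A) n : upd a n (a n) = a.
Proof. by apply/funext => i; rewrite /upd; case: eqP => [->|]. Qed.

Lemma upd_comp (A B : Type) (h : A -> B) (a : nat -> A) n x :
  upd (fun i => h (a i)) n (h x) = fun i => h (upd a n x i).
Proof. by apply/funext => i; rewrite /upd; case: eqP. Qed.

Lemma eq_sat (A : struct) f (a b : nat -> A) :
  (forall i, i \in fv f -> a i = b i) -> sat a f <-> sat b f.
Proof.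
elim: f a b => //= [u v|g IH|g IHg h IHh|g IHg h IHh|g IHg h IHh|n g IH|n g IH] a b Hab.
- have Hu : eval a u = eval b u.
    apply: (@eq_eval (mem (tvars u ++ tvars v))) => //.
    by apply/allP => i Hi; rewrite inE mem_cat Hi.
  have -> : eval a v = eval b v.
    apply: (@eq_eval (mem (tvars u ++ tvars v))) => //.
    by apply/allP => i Hi; rewrite inE mem_cat Hi orbT.
  by rewrite Hu.
- by rewrite (IH _ b).
- by rewrite (IHg _ b) ?(IHh _ b) // => i Hi; apply: Hab; rewrite mem_cat Hi ?orbT.
- by rewrite (IHg _ b) ?(IHh _ b) // => i Hi; apply: Hab; rewrite mem_cat Hi ?orbT.
- by rewrite (IHg _ b) ?(IHh _ b) // => i Hi; apply: Hab; rewrite mem_cat Hi ?orbT.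
- have H x : sat (upd a n x) g <-> sat (upd b n x) g.
    apply: IH => i Hi; rewrite /upd; case: eqP => // /eqP Hn; apply: Hab.
    by rewrite mem_filter Hn.
  by split=> Hs x; apply/H.
- have H x : sat (upd a n x) g <-> sat (upd b n x) g.
    apply: IH => i Hi; rewrite /upd; case: eqP => // /eqP Hn; apply: Hab.
    by rewrite mem_filter Hn.
  by split=> -[x Hs]; exists x; apply/H.
Qed.

Lemma sat_qf_emb (A B : struct) (h : A -> B) f (a : nat -> A) :
  embedding h -> qfree f -> sat (fun i => h (a i)) f <-> sat a f.
Proof.
move=> Hh; elim: f => //= [u v _|g IH /IH ->//|g IHg g' IHh|g IHg g' IHh|g IHg g' IHh].
  exact: (holds_emb a (u, v) Hh).
all: by case/andP=> /IHg -> /IHh ->.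
Qed.

Definition fclose (f : form) : form := foldr fall f (fv f).

Lemma fclose_sentence f : sentence (fclose f).
Proof.
rewrite /sentence /fclose.
have H s : fv (foldr fall f s) = seq.filter (fun m => m \notin s) (fv f).
  elim: s => [|n s IH] /=; first by rewrite filter_predT.
  rewrite IH -filter_predI; apply: eq_filter => m /=.
  by rewrite inE negb_or.
rewrite H; apply/eqP; rewrite -size_eq0 size_filter eqn0Ngt -has_count.
by apply/hasPn => i Hi; rewrite negbK.
Qed.

Lemma fclose_universal f : qfree f -> universal (fclose f).
Proof. by move=> Hf; rewrite /fclose; elim: (fv f) => //=; case: f Hf. Qed.

Lemma sat_fclose (A : struct) f :
  (forall a : nat -> A, sat a (fclose f)) <-> (forall a : nat -> A, sat a f).
Proof.
rewrite /fclose; elim: (fv f) => //= n s <-.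
by split=> [H a|H a x]; [rewrite -(upd_same a n)|]; apply: H.
Qed.

(** The universal closure of each defining equation is itself a sentence of [ThV V]. *)
Lemma model_ThV V A : eq_class V -> model (ThV V) A <-> V A.
Proof.
move=> [E HE]; split=> [H|H f [_ Hf]]; last exact: Hf.
apply/HE => e He; apply: ((sat_fclose A (feq e.1 e.2)).1 _) => a.
apply: H; split; first exact: fclose_sentence.
by move=> B HB; apply/sat_fclose => b; apply: ((HE B).1 HB e He).
Qed.

Lemma dependent_choice (I : Type) (A : I -> Type) (P : forall i, A i -> Prop) :
  (forall i, exists x, P i x) -> exists f : forall i, A i, forall i, P i (f i).
Proof. by move=> H; exists (fun i => sval (cid (H i))) => i; case: cid. Qed.

Section Ultraproduct.
Variables (I : Type) (U : set_system I) (HU : UltraFilter U) (A : I -> struct).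
Local Open Scope classical_set_scope.

Let US (P Q : set I) : (forall i, P i -> Q i) -> U P -> U Q.
Proof. exact: filterS. Qed.

Definition ueq (x y : prod_struct A) : Prop := U [set i | x i = y i].

Lemma ueq_congruence : congruence ueq.
Proof.
rewrite /ueq; split=> [x|]; first exact: (US _ filterT).
split=> [x y|]; first by apply: US => i /= ->.
split=> [x y z h1 h2|op Hop x x' y y' h1 h2].
  by apply: US (filterI h1 h2) => i /= [-> ->].
apply: US (filterI h1 h2) => i /= [e1 e2].
by case: Hop => [->|[->|[->|[->|->]]]] /=; rewrite e1 e2.
Qed.

Definition uprod : struct := quot ueq_congruence.
Definition ucl (x : prod_struct A) : uprod := @qcl _ _ ueq_congruence x.

Lemma ultraN (P : set I) : U (~` P) <-> ~ U P.
Proof.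
split=> [h1 h2|h]; last by case: (in_ultra_setVsetC P HU).
by apply: (filter_not_empty U); rewrite -(setICl P); apply: filterI.
Qed.

Lemma los_upd g n :
  (forall a : nat -> prod_struct A,
     sat (fun n => ucl (a n)) g <-> U [set i | sat (fun n => a n i) g]) ->
  forall (a : nat -> prod_struct A) x, sat (upd (fun n => ucl (a n)) n (ucl x)) g <->
      U [set i | sat (upd (fun n => a n i) n (x i)) g].
Proof.
move=> IH a x; rewrite (upd_comp ucl) IH.
by under [X in U X <-> _]eq_fun do rewrite -(upd_comp (fun y : prod_struct A => y _)).
Qed.

(** Łoś's theorem. At a quantifier, choosing a point in every coordinate gives one element of the
    product that tests the formula. *)
Lemma los f (a : nat -> prod_struct A) :
  sat (fun n => ucl (a n)) f <-> U [set i | sat (fun n => a n i) f].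
Proof.
elim: f a => /= [|u v|g IH|g IHg g' IHg'|g IHg g' IHg'|g IHg g' IHg'|n g IH|n g IH] a.
- by split=> // h; apply: (filter_not_empty U); apply: US h.
- rewrite -!(eval_hom _ _ (qcl_hom ueq_congruence)) qclE /ueq.
  by under eq_fun do rewrite !eval_prod.
- by rewrite IH -ultraN.
- rewrite IHg IHg'; split=> [[h1 h2]|h]; first exact: filterI.
  by split; apply: US h => i [].
- rewrite IHg IHg'; split=> [[]|h].
  + by apply: US => i; left.
  + by apply: US => i; right.
  + apply: contrapT => /not_orP[/ultraN h1 /ultraN h2].
    apply: (filter_not_empty U); apply: US (filterI h (filterI h1 h2)) => i [] /= h3 [] /= h4 h5.
    by case: h3 => [/h4|/h5].
- rewrite IHg IHg'; split=> [h|h h1].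
  + case: (EM (U [set i | sat (fun n => a n i) g])) => [/h|/ultraN]; first by apply: US => i /= + _.
    by apply: US => i /= h1 /h1.
  + by apply: US (filterI h h1) => i /= []; apply.
- split=> [h|h x]; last first.
    rewrite -(qcl_sval x : ucl _ = x); apply: (proj2 (los_upd n IH _ _)); by apply: US h => i /=; apply.
  (* In each coordinate [y] is a counterexample to [g] if there is one; [g] at the chosen element
     therefore forces the universal statement on a set of [U]. *)
  have H i : exists y : A i,
     sat (upd (fun n => a n i) n y) g -> forall y, sat (upd (fun n => a n i) n y) g.
    case: (EM (forall y, sat (upd (fun n => a n i) n y) g)) => [|/existsNP[y Hy]].
      by exists (s_one _).
    by exists y.
  have [x Hx] := dependent_choice H.
  by move: (proj1 (los_upd n IH _ _) (h (ucl x))); apply: US => i /= /Hx.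
- split=> [[x]|h].
    by rewrite -(qcl_sval x : ucl _ = x) => /(proj1 (los_upd n IH _ _)); apply: US => i /=; exists (sval x i).
  have H i : exists z : A i,
     (exists y, sat (upd (fun n => a n i) n y) g) -> sat (upd (fun n => a n i) n z) g.
    case: (EM (exists y, sat (upd (fun n => a n i) n y) g)) => [[y Hy]|]; first by exists y.
    by exists (s_one _).
  have [x Hx] := dependent_choice H.
  by exists (ucl x); apply: (proj2 (los_upd n IH _ _)); apply: US h => i /= /Hx.
Qed.
End Ultraproduct.

(** [X] is a set of new constants, and [S] a set of formulas whose variables are instantiated by
    constants. With [X] an algebra this treats diagrams, with [X = nat] and instantiation [id] it
    treats types. *)
Lemma compactness (T : theory) (X : Type) (S : form -> (nat -> X) -> Prop) :
  (forall L : list (form * (nat -> X)), (forall p, List.In p L -> S p.1 p.2) ->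
     exists N : struct, model T N /\
       exists v : X -> N, forall p, List.In p L -> sat (fun i => v (p.2 i)) p.1) ->
  exists N : struct, model T N /\
    exists v : X -> N, forall f a, S f a -> sat (fun i => v (a i)) f.
Proof.
move=> HS; pose I := {L : list (form * (nat -> X)) | forall p, List.In p L -> S p.1 p.2}.
have HI (L : I) : exists N : struct, model T N /\
    exists v : X -> N, forall p, List.In p (sval L) -> sat (fun i => v (p.2 i)) p.1.
  by apply: HS => p; apply: (proj2_sig L).
have [A HA] := choice HI.
have HT L := proj1 (HA L); have [v Hv] := dependent_choice (fun L => proj2 (HA L)).
(* The filter generated by the cones of all finite lists extending a given one. An ultrafilter above
   it makes each formula of [S] true on a large set of indices. *)
pose F : set_system I := fun P => exists L0 : I, forall L : I, List.incl (sval L0) (sval L) -> P L.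
have FF : ProperFilter F.
  split; first by case=> L0 /(_ L0); apply; apply: List.incl_refl.
  split.
  - have H p : List.In p nil -> S p.1 p.2 by [].
    by exists (exist _ nil H).
  - move=> P Q [L1 H1] [L2 H2].
    have H p : List.In p (sval L1 ++ sval L2)%list -> S p.1 p.2.
      by move=> /List.in_app_iff[]; [apply: (proj2_sig L1)|apply: (proj2_sig L2)].
    exists (exist _ _ H) => L HL; split.
      by apply: H1 => p Hp; apply: HL; apply/List.in_app_iff; left.
    by apply: H2 => p Hp; apply: HL; apply/List.in_app_iff; right.
  - by move=> P Q PQ [L0 HL0]; exists L0 => L /HL0 /PQ.
have [U [HU FU]] := ultraFilterLemma FF.
exists (uprod HU A); split.
  move=> f Tf a.
  have -> : a = fun n => ucl HU (sval (a n)) by apply/funext => n; rewrite /ucl qcl_sval.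
  apply/los; apply: (@filterS _ U _ setT); last exact: filterT.
  by move=> L _; apply: HT.
exists (fun x => ucl HU (fun L => v L x)) => f a Sfa; apply/los.
have H p : List.In p ((f, a) :: nil)%list -> S p.1 p.2 by case=> // <-.
apply: FU; exists (exist _ _ H) => L HL /=.
by apply: (Hv L (f, a)); apply: HL; left.
Qed.

(** A product with one factor refuting each equation that does not follow from [S]. It replaces the
    algebra presented by [S]: the equations true of [v] are exactly the consequences of [S] in [V],
    though [v] need not generate it. *)
Lemma exact_model V (X : Type) (S : eqn -> (nat -> X) -> Prop) : eq_class V ->
  exists F : struct, V F /\ exists v : X -> F,
    (forall e a, S e a -> holds (fun i => v (a i)) e) /\
    (forall e a, holds (fun i => v (a i)) e ->
       forall B, V B -> forall d : X -> B,
         (forall e a, S e a -> holds (fun i => d (a i)) e) -> holds (fun i => d (a i)) e).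
Proof.
move=> HV.
pose I := {p : eqn * (nat -> X) | exists B : struct, V B /\ exists d : X -> B,
  (forall e a, S e a -> holds (fun i => d (a i)) e) /\ ~ holds (fun i => d (p.2 i)) p.1}.
have [A HA] := choice (fun i : I => proj2_sig i).
have VA i := proj1 (HA i); have [d Hd] := dependent_choice (fun i => proj2 (HA i)).
exists (prod_struct A); split; first exact: class_prod.
exists (fun x i => d i x); split=> [e a Sea|e a He B VB d' Hd'].
  by apply/holds_prod => i; apply: (Hd i).1.
apply: contrapT => H.
have Hi : exists B : struct, V B /\ exists d : X -> B,
  (forall e a, S e a -> holds (fun i => d (a i)) e) /\ ~ holds (fun i => d ((e, a).2 i)) (e, a).1.
  by exists B; split=> //; exists d'.
apply: (Hd (exist _ (e, a) Hi)).2.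
by move/holds_prod: He => /(_ (exist _ (e, a) Hi)).
Qed.

(** * Finite conjunctions, disjunctions and diagrams *)

Definition fverum : form := feq tone tone.
Definition fconj (l : list form) : form := List.fold_right fand fverum l.
Definition fdisj (l : list form) : form := List.fold_right for_ fbot l.
Definition feqn (e : eqn) : form := feq e.1 e.2.

Lemma sat_fconj (A : struct) (a : nat -> A) l :
  sat a (fconj l) <-> forall f, List.In f l -> sat a f.
Proof.
elim: l => [|f l IH] /=; first by split.
rewrite IH; split=> [[H1 H2] g [<- //|]|H]; first exact: H2.
by split=> [|g Hg]; apply: H; [left|right].
Qed.

Lemma sat_fdisj (A : struct) (a : nat -> A) l :
  sat a (fdisj l) <-> exists f, List.In f l /\ sat a f.
Proof.
elim: l => [|f l IH] /=; first by split=> // -[f []].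
rewrite IH; split=> [[H|[g [Hg H]]]|[g [[<-|Hg] H]]]; last by right; exists g.
- by exists f; split=> //; left.
- by exists g; split=> //; right.
- by left.
Qed.

Lemma qfree_fconj l : (forall f, List.In f l -> qfree f) -> qfree (fconj l).
Proof.
elim: l => //= f l IH H; rewrite H ?IH //; last by left.
by move=> g Hg; apply: H; right.
Qed.

Lemma qfree_fdisj l : (forall f, List.In f l -> qfree f) -> qfree (fdisj l).
Proof.
elim: l => //= f l IH H; rewrite H ?IH //; last by left.
by move=> g Hg; apply: H; right.
Qed.

Lemma fv_fconj (P : pred nat) l :
  (forall f, List.In f l -> all P (fv f)) -> all P (fv (fconj l)).
Proof.
elim: l => //= f l IH H; rewrite all_cat H ?IH //; last by left.
by move=> g Hg; apply: H; right.
Qed.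

Definition eqns_form (E : list eqn) : form := fconj (List.map feqn E).

Lemma sat_eqns_form (A : struct) (a : nat -> A) E : sat a (eqns_form E) <-> holds_all a E.
Proof.
rewrite sat_fconj; split=> [H e He|H f /List.in_map_iff[e [<- /H]] //].
by apply: (H (feqn e)); apply: List.in_map.
Qed.

Lemma qfree_eqns_form E : qfree (eqns_form E).
Proof. by apply: qfree_fconj => f /List.in_map_iff[e [<-]]. Qed.

Lemma fv_eqns_form (P : pred nat) E : eqns_vars_in P E -> all P (fv (eqns_form E)).
Proof. by move/eqns_vars_inP => H; apply: fv_fconj => f /List.in_map_iff[e [<-]] /H. Qed.

(** Intended for quantifier-free formulas, where no variable can be captured; quantified formulas
    are returned unchanged. *)
Fixpoint fsub (s : nat -> term) (f : form) : form :=
  match f with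
  | fbot => fbot
  | feq u v => feq (tsub s u) (tsub s v)
  | fneg g => fneg (fsub s g)
  | fand g h => fand (fsub s g) (fsub s h)
  | for_ g h => for_ (fsub s g) (fsub s h)
  | fimp g h => fimp (fsub s g) (fsub s h)
  | fall _ _ | fex _ _ => f
  end.

Lemma sat_fsub (A : struct) (a : nat -> A) s f :
  qfree f -> sat a (fsub s f) <-> sat (fun i => eval a (s i)) f.
Proof.
elim: f => //= [u v _|g IH /IH ->//|g IHg g' IHh|g IHg g' IHh|g IHg g' IHh].
  by rewrite !eval_tsub.
all: by case/andP=> /IHg -> /IHh ->.
Qed.

Lemma qfree_fsub s f : qfree (fsub s f) = qfree f.
Proof. by elim: f => //= g -> h ->. Qed.

(** Turns finitely many elements into variables: [r] picks a position in the list and [v] decodes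
    it. *)
Lemma coding (X : Type) (x0 : X) (l : list X) :
  exists (r : X -> nat) (v : nat -> X), forall x, List.In x l -> v (r x) = x.
Proof.
have H x : exists n, List.In x l -> List.nth n l x0 = x.
  case: (EM (List.In x l)) => [Hx|]; last by exists 0.
  by have [n [_ Hn]] := List.In_nth l x x0 Hx; exists n.
have [r Hr] := choice H.
by exists r, (fun n => List.nth n l x0).
Qed.

(* Variables of a single formula code the finitely many parameters that occur. *)
Lemma finite_diagram (X : Type) (x0 : X) (l : list X) (L : list (form * (nat -> X))) :
  (forall p, List.In p L -> qfree p.1) ->
  exists (F : form) (r : X -> nat) (v : nat -> X),
    qfree F /\ (forall x, List.In x l -> v (r x) = x) /\
    (forall p, List.In p L -> forall i, i \in fv p.1 -> v (r (p.2 i)) = p.2 i) /\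
    (forall (N : struct) (d : nat -> N),
       sat d F <-> forall p, List.In p L -> sat (fun i => d (r (p.2 i))) p.1).
Proof.
move=> HL.
have [l' Hl'] : exists l' : list X, forall p, List.In p L -> forall i, i \in fv p.1 -> List.In (p.2 i) l'.
  elim: L {HL} => [|p L [l' IH]]; first by exists nil.
  exists (List.map p.2 (fv p.1) ++ l')%list => q [<- i Hi|Hq i Hi]; apply/List.in_app_iff.
    left; apply: List.in_map; elim: (fv p.1) Hi => // j s IHs; rewrite inE => /orP[/eqP->|/IHs]; by [left|right].
  by right; apply: IH Hq i Hi.
have [r [v Hv]] := coding x0 (l ++ l')%list.
exists (fconj (List.map (fun p => fsub (fun i => tvar (r (p.2 i))) p.1) L)), r, v.
split; first by apply: qfree_fconj => f /List.in_map_iff[p [<- Hp]]; rewrite qfree_fsub; apply: HL.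
split; first by move=> x Hx; apply: Hv; apply/List.in_app_iff; left.
split; first by move=> p Hp i Hi; apply: Hv; apply/List.in_app_iff; right; apply: Hl'.
move=> N d; rewrite sat_fconj; split=> [H p Hp|H f /List.in_map_iff[p [<- Hp]]].
  have := H _ (List.in_map (fun p => fsub (fun i => tvar (r (p.2 i))) p.1) _ _ Hp).
  by rewrite sat_fsub //; apply: HL.
by rewrite sat_fsub; [apply: H|apply: HL].
Qed.

Lemma diagram_embedding (M N : struct) (h : M -> N) :
  (forall f (a : nat -> M), qfree f -> sat a f -> sat (fun i => h (a i)) f) -> embedding h.
Proof.
move=> H; have E u v (a : nat -> M) : eval a u = eval a v ->
  eval (fun i => h (a i)) u = eval (fun i => h (a i)) v by move=> e; apply: (H (feq u v) a).
pose asg (x y : M) i := nth x [:: x; y] i.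
split; last first.
  move=> x y e; apply: contrapT => ne.
  by apply: (H (fneg (feq (tvar 0) (tvar 1))) (asg x y)).
have E2 (op : forall S : struct, S -> S -> S) top x y :
   (forall (S : struct) (a : nat -> S) s t, eval a (top s t) = op S (eval a s) (eval a t)) ->
   h (op _ x y) = op _ (h x) (h y).
  move=> He; pose asg3 i := nth x [:: x; y; op _ x y] i.
  have := E (tvar 2) (top (tvar 0) (tvar 1)) asg3; rewrite !He /=; exact.
split=> [x y|]; first exact: (E2 (@s_meet) tmeet).
split=> [x y|]; first exact: (E2 (@s_join) tjoin).
split=> [x y|]; first exact: (E2 (@s_mul) tmul).
split=> [x y|]; first exact: (E2 (@s_ldiv) tldiv).
split=> [x y|]; first exact: (E2 (@s_rdiv) trdiv).
by split; [apply: (E (tvar 0) tone (fun _ => s_one M))|apply: (E (tvar 0) tzero (fun _ => s_zero M))].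
Qed.

(** By compactness only finite parts of the diagram of [M] matter, and [finite_diagram] packs each
    of them into one quantifier-free formula. *)
Lemma embed_in_model (T : theory) (M : struct) :
  (forall f (a : nat -> M), qfree f -> sat a f ->
     exists N, model T N /\ exists b : nat -> N, sat b f) ->
  exists N, model T N /\ exists h : M -> N, embedding h.
Proof.
move=> H; have [L HL|N [TN [v Hv]]] := @compactness T M (fun f a => qfree f /\ sat a f).
  have [|F [r [v [HF [_ [Hv HFv]]]]]] := @finite_diagram M (s_one M) nil L.
    by move=> p /HL[].
  have [|N [TN [b Hb]]] := H F v HF.
    apply/HFv => p Hp; have [_] := HL p Hp.
    by apply: (proj1 (eq_sat _)) => i /(Hv _ Hp).
  exists N; split=> //; exists (fun x => b (r x)) => p Hp.
  by move/HFv: Hb; apply.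
exists N; split=> //; exists v; apply: diagram_embedding => f a Hf Ha.
exact: Hv.
Qed.

(** * Congruence extension and restriction of equations *)

Lemma InP (T : eqType) (x : T) s : List.In x s <-> x \in s.
Proof.
elim: s => //= y s IH; rewrite inE IH; split=> [[->|->]|/orP[/eqP->|]]; rewrite ?eqxx ?orbT //.
  by left.
by right.
Qed.

Lemma quot_lift (A B : struct) th (Hth : congruence th) (g : A -> B) :
  is_hom g -> (forall x y, th x y -> g x = g y) ->
  exists g' : quot Hth -> B, is_hom g' /\ forall x, g' (qcl Hth x) = g x.
Proof.
move=> [g1 [g2 [g3 [g4 [g5 [g6 g7]]]]]] Hg.
have E x : g (sval (qcl Hth x)) = g x.
  by apply/esym/Hg; apply: crepP.
exists (fun x => g (sval x)); split=> //.
by do 6?split=> *; rewrite E.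
Qed.

(** A deduction theorem, by induction on [gam]: an equation [g] is moved into the conclusion by
    replacing each equation [e] by the system saying that [e] lies in the congruence generated by
    [g]. *)
Lemma edpc_deduction V : eq_class V -> EDPC V -> forall gam del : list eqn,
  exists th : list eqn,
    (forall P : pred nat, eqns_vars_in P gam -> eqns_vars_in P del -> eqns_vars_in P th) /\
    (forall A, V A -> forall a : nat -> A, holds_all a th <->
       forall B, V B -> forall h : A -> B, is_hom h ->
         holds_all (fun i => h (a i)) gam -> holds_all (fun i => h (a i)) del).
Proof.
move=> HV [al [Hal HE]]; elim=> [|g gam IH] del.
  exists del; split=> // A VA a; split=> [H B VB h Hh _|H]; first exact: holds_all_hom.
  by apply: (H A VA id).
have [th [Hth1 Hth2]] := IH del.
exists (List.flat_map (fun e => List.map (esub (asg4 e.1 e.2 g.1 g.2)) al) th); split.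
  move=> P /eqns_vars_in_cons[Hg Hgam] Hdel; have Hth := Hth1 P Hgam Hdel.
  move=> e /List.in_flat_map[e' [/Hth/andP[H1 H2] He]].
  move: Hg; rewrite all_cat => /andP[H3 H4].
  apply: (@eqns_vars_in_esub _ P _ _ Hal) He => -[|[|[|[|i]]]] //.
move=> A VA a.
have E : holds_all a (List.flat_map (fun e => List.map (esub (asg4 e.1 e.2 g.1 g.2)) al) th) <->
    forall e, List.In e th -> Cg (eval a g.1) (eval a g.2) (eval a e.1) (eval a e.2).
  have X e : holds_all a (List.map (esub (asg4 e.1 e.2 g.1 g.2)) al) <->
      Cg (eval a g.1) (eval a g.2) (eval a e.1) (eval a e.2).
    rewrite holds_all_esub HE //.
    by have -> : (fun i => eval a (asg4 e.1 e.2 g.1 g.2 i)) =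
        asg4 (eval a e.1) (eval a e.2) (eval a g.1) (eval a g.2)
      by apply/funext => -[|[|[|[|i]]]].
  split=> [H e He|H e /List.in_flat_map[e' [/H/X H' He]]]; last exact: H'.
  by apply/X => e' He'; apply: H; apply/List.in_flat_map; exists e.
rewrite {}E; split=> [H B VB h Hh /holds_all_cons[Hg Hgam]|H e He th' Hc Hg].
  suff /Hth2 : holds_all (fun i => h (a i)) th by move=> /(_ VB B VB id); apply.
  move=> e /H He; rewrite /holds -!(eval_hom _ _ Hh).
  by apply: (He _ (ker_congruence Hh)); rewrite !(eval_hom _ _ Hh).
(* Membership in the generated congruence is tested in the quotient by an arbitrary congruence
   identifying the two sides of [g]. *)
have Hq := qcl_hom Hc; have VQ := class_quot Hc HV VA.
have : holds_all (fun i => qcl Hc (a i)) th.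
  apply/Hth2 => // B VB h Hh Hgam.
  apply: (H B VB (fun x => h (qcl Hc x))); first exact: hom_comp.
  apply/holds_all_cons; split=> //.
  apply: (@holds_hom (quot Hc) B h (fun i => qcl Hc (a i))) => //.
  by rewrite /holds -!(eval_hom _ _ Hq); apply/qclE.
by move=> /(_ e He); rewrite /holds -!(eval_hom _ _ Hq) => /qclE.
Qed.

(* Together, congruence extension and amalgamation let embeddings be pushed out along
   arbitrary homomorphisms. *)
Lemma transfer V : eq_class V -> EDPC V -> AP V ->
  forall Q P A : struct, V Q -> V P -> V A ->
  forall (j : Q -> P) (k : Q -> A), embedding j -> is_hom k ->
  exists (B : struct) (i : P -> B) (l : A -> B),
    V B /\ is_hom i /\ embedding l /\ forall q, i (j q) = l (k q).
Proof.
move=> HV HE HAP Q P A VQ VP VA j k Hj Hk.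
(* The congruence generated in [P] by the image of the kernel of [k], in finitary form: finitely
   many pairs of the kernel already force [x] and [y] together in every image of [P] in [V]. *)
pose Th x y := exists L : list (Q * Q), (forall p, List.In p L -> k p.1 = k p.2) /\
  forall B, V B -> forall h : P -> B, is_hom h ->
    (forall p, List.In p L -> h (j p.1) = h (j p.2)) -> h x = h y.
have HTh : congruence Th.
  split=> [x|]; first by exists nil.
  split=> [x y [L [H1 H2]]|].
    by exists L; split=> // B VB h Hh /(H2 B VB h Hh).
  split=> [x y z [L [H1 H2]] [L' [H1' H2']]|op Hop x x' y y' [L [H1 H2]] [L' [H1' H2']]].
    exists (L ++ L')%list; split=> [p /List.in_app_iff[/H1|/H1'] //|B VB h Hh H].
    rewrite (H2 B VB h Hh) ?(H2' B VB h Hh) // => p Hp; apply: H; apply/List.in_app_iff;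
      by [right|left].
  exists (L ++ L')%list; split=> [p /List.in_app_iff[/H1|/H1'] //|B VB h Hh H].
  have e1 : h x = h x'.
    by apply: H2 => // p Hp; apply: H; apply/List.in_app_iff; left.
  have e2 : h y = h y'.
    by apply: H2' => // p Hp; apply: H; apply/List.in_app_iff; right.
  by apply: (ker_congruence Hh).2.2.2.
(* Congruence extension: [Th] identifies nothing in [Q] beyond the kernel of [k]. The deduction
   theorem expresses the implication by equations, and these pass from [P] back to [Q] along the
   embedding [j]. *)
have key q q' : Th (j q) (j q') -> k q = k q'.
  move=> [L [H1 H2]].
  have [r [v Hv]] := coding (s_one Q) (q :: q' :: List.flat_map (fun p => p.1 :: p.2 :: nil) L)%list.
  have Hq : v (r q) = q by apply: Hv; left.
  have Hq' : v (r q') = q' by apply: Hv; right; left.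
  have HL p : List.In p L -> v (r p.1) = p.1 /\ v (r p.2) = p.2.
    by move=> Hp; split; apply: Hv; right; right; apply/List.in_flat_map; exists p; split=> //=; auto.
  have [th [_ Hth]] := edpc_deduction HV HE
    (List.map (fun p => (tvar (r p.1), tvar (r p.2))) L) ((tvar (r q), tvar (r q')) :: nil)%list.
  have : holds_all (fun i => j (v i)) th.
    apply/Hth => // B VB h Hh H e [<-|//]; rewrite /holds /= Hq Hq'; apply: (H2 B VB h Hh) => p Hp.
    have := H _ (List.in_map (fun p => (tvar (r p.1), tvar (r p.2))) _ _ Hp).
    by rewrite /holds /= (HL p Hp).1 (HL p Hp).2.
  move/(holds_all_emb _ _ Hj)/(proj1 (Hth Q VQ v))/(_ A VA k Hk) => H.
  have := H _ (tvar (r q), tvar (r q')); rewrite /holds /= Hq Hq'; apply; last by left.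
  move=> e /List.in_map_iff[p [<- Hp]]; rewrite /holds /= (HL p Hp).1 (HL p Hp).2.
  exact: H1.
(* The quotient of [Q] by the kernel embeds both in [A] and in the quotient of [P] by [Th]; these
   two extensions are amalgamated. *)
pose A0 := quot (ker_congruence Hk).
have VA0 : V A0 by apply: class_quot.
have VG : V (quot HTh) by apply: class_quot.
have [k' [Hk' k'E]] := quot_lift (ker_congruence Hk) Hk (fun x y e => e).
have Hg : is_hom (fun q => qcl HTh (j q)) by apply: hom_comp (qcl_hom HTh); apply: Hj.1.
have [|g' [Hg' g'E]] := quot_lift (ker_congruence Hk) Hg.
  move=> x y e; apply/qclE; exists ((x, y) :: nil)%list; split=> [p [<-|]|B VB h Hh H] //.
  by apply: (H (x, y)); left.
have Ik : embedding k'.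
  split=> // x y; rewrite -(qcl_sval x) -(qcl_sval y) !k'E => e; exact/qclE.
have Ig : embedding g'.
  split=> // x y; rewrite -(qcl_sval x) -(qcl_sval y) !g'E => /qclE/key e; exact/qclE.
have [D [h [l [VD [Hh [Hl E]]]]]] := HAP A0 A (quot HTh) VA0 VA VG k' g' Ik Ig.
exists D, (fun x => l (qcl HTh x)), h; split=> //; split.
  by apply: (hom_comp (qcl_hom HTh)); apply: Hl.1.
by split=> // q; rewrite -k'E E g'E.
Qed.

(** * Finitely presented algebras and elimination of a variable from equations *)

Lemma fp_exists V n (R : list eqn) : eq_class V -> eqns_vars_in (fun i => i < n) R ->
  exists P, V P /\ exists g : nat -> P,
    (forall x, exists t, all (fun i => i < n) (tvars t) /\ x = eval g t) /\
    holds_all g R /\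
    (forall B, V B -> forall d : nat -> B, holds_all d R ->
       exists h : P -> B, is_hom h /\ forall i, i < n -> h (g i) = d i).
Proof.
move=> HV HR.
have [F [VF [v [v1 v2]]]] := @exact_model V nat (fun e a => a = id /\ List.In e R) HV.
exists (gen_sub n v); split; first exact: class_sub.
have [g Hg] := sub_gens n v; exists g; split.
  move=> x; have [t [Ht ->]] := sub_elP x; exists t; split=> //.
  apply: (sub_emb n v).2; rewrite (eval_hom _ _ (sub_emb n v).1) /=.
  by apply: eq_eval Ht _ => i Hi; rewrite Hg.
split.
  apply/(holds_all_emb _ _ (sub_emb n v)); apply: (@eq_holds_all _ _ v _ R HR) => [i Hi|e He].
    by rewrite Hg.
  exact: (v1 e id).
move=> B VB d Hd.
have [|h [Hh hE]] := @sub_lift F B n v d.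
  move=> s t Hs Ht e; apply: (v2 (s, t) id e B VB d) => e' a [-> He']; exact: Hd.
exists h; split=> // i Hi; apply: (hE (tvar i)); rewrite /= ?Hi //; exact: Hg.
Qed.

(** Finite presentability does not depend on the generators: the old relations are rewritten through
    the terms [u] for the old generators, and the relations [b i = w i] at [u] let the new
    generators be recovered. *)
Lemma fp_generators V (A : struct) m (b : nat -> A) : fin_presented V A ->
  (forall x, exists t, all (fun i => i < m) (tvars t) /\ x = eval b t) ->
  exists R, eqns_vars_in (fun i => i < m) R /\ holds_all b R /\
    forall B, V B -> forall d : nat -> B, holds_all d R ->
      exists h : A -> B, is_hom h /\ forall i, i < m -> h (b i) = d i.
Proof.
move=> [VA [n [g [R [gg [HR [gR gh]]]]]]] bb.
have [u Hu] := choice (fun i => bb (g i)); have [w Hw] := choice (fun i => gg (b i)).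
exists (List.map (esub u) R ++ List.map (fun i => (tvar i, tsub u (w i))) (iota 0 m))%list.
have ug : (fun i => eval b (u i)) = g by apply/funext => i; rewrite -(Hu i).2.
split; last split.
- apply/eqns_vars_in_app; split.
    by apply: eqns_vars_in_esub HR _ => i _; apply: (Hu i).1.
  move=> e /List.in_map_iff[i [<- /InP]] /=; rewrite mem_iota /= add0n => ->.
  by rewrite tvars_tsub; apply: sub_all (Hw i).1 => k _; apply: (Hu k).1.
- apply/holds_all_app; split; first by apply/holds_all_esub; rewrite ug.
  by move=> e /List.in_map_iff[i [<- _]]; rewrite /holds /= eval_tsub ug; apply: (Hw i).2.
move=> B VB d /holds_all_app[/holds_all_esub H1 H2].
have [h [Hh hE]] := gh B VB _ H1.
exists h; split=> // i Hi.
have <- : eval d (tsub u (w i)) = d i.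
  apply/esym; apply: (H2 (tvar i, tsub u (w i))).
  by apply: (List.in_map (fun i => (tvar i, tsub u (w i)))); apply/InP; rewrite mem_iota.
rewrite (Hw i).2 (eval_hom _ _ Hh) eval_tsub; apply: eq_eval (Hw i).1 _ => k; exact: hE.
Qed.

(** [Pi] presents the subalgebra [Q], generated by the variables other than [y], of the algebra [P]
    presented by [gam]. A solution of [Pi] in [A] is then a homomorphism from [Q], ready to be
    pushed out along the inclusion in [P]. *)
Lemma coherent_restriction V : eq_class V -> coherent V ->
  forall n y gam, eqns_vars_in (fun i => i < n) gam ->
  exists Pi, eqns_vars_in (fun i => (i < n) && (i != y)) Pi /\
    (forall A, V A -> forall a : nat -> A, holds_all a gam -> holds_all a Pi) /\
    (forall A, V A -> forall a : nat -> A, holds_all a Pi ->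
       exists (P Q : struct) (j : Q -> P) (k : Q -> A) (p : nat -> P) (q : nat -> Q),
         V P /\ V Q /\ embedding j /\ is_hom k /\ holds_all p gam /\
         forall i, i < n -> i != y -> j (q i) = p i /\ k (q i) = a i).
Proof.
move=> HV HC n y gam Hgam.
have [P [VP [g [gg [gR gh]]]]] := fp_exists HV Hgam.
have FP : fin_presented V P by split=> //; exists n, g, gam.
(* Replacing the generator at [y] by the unit removes it from the subalgebra without renumbering;
   [sg] makes the same replacement in the relations. *)
pose b := upd g y (s_one P); pose Q := gen_sub n b.
have FQ : fin_presented V Q by apply: HC.
have [q Hq] := sub_gens n b.
have qb i : i < n -> sval (q i) = b i := Hq i.
have [|R [HR [qR qh]]] := @fp_generators V Q n q FQ.
  move=> x; have [t [Ht ->]] := sub_elP x; exists t; split=> //.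
  apply: (sub_emb n b).2; rewrite (eval_hom _ _ (sub_emb n b).1) /=.
  by apply: eq_eval Ht _ => i Hi; rewrite Hq.
pose sg := upd tvar y tone.
have sgE (A : struct) (a : nat -> A) : (fun i => eval a (sg i)) = upd a y (s_one A).
  by apply/funext => i; rewrite /sg /upd; case: eqP.
exists (List.map (esub sg) R); split.
  apply: eqns_vars_in_esub HR _ => i Hi; rewrite /sg /upd; case: eqP => //= /eqP ->.
  by rewrite Hi.
split=> A VA a.
  move=> Ha; apply/holds_all_esub; rewrite sgE.
  have [h [Hh hE]] := gh A VA a Ha.
  have Hs := (sub_emb n b).1.
  have := holds_all_hom (hom_comp Hs Hh) qR; apply: eq_holds_all HR _ => i Hi.
  rewrite qb // /b /upd; case: eqP => // _; last exact: hE.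
  by case: Hh => [_ [_ [_ [_ [_ [-> _]]]]]].
move/holds_all_esub; rewrite sgE => Ha.
have [k [Hk kE]] := qh A VA _ Ha.
exists P, Q, (fun x => sval x), k, g, q; split=> //; split; first exact: class_sub.
split; first exact: sub_emb.
split=> //; split=> // i Hi Hy; rewrite kE // qb // /b /upd (negbTE Hy); done.
Qed.

(** Compactness applied to [S], [gam] and the negation of [d]. *)
Lemma finite_consequence V (S : eqn -> Prop) gam d : eq_class V ->
  (forall B, V B -> forall b : nat -> B, (forall e, S e -> holds b e) -> holds_all b gam -> holds b d) ->
  exists phi : list eqn, (forall e, List.In e phi -> S e) /\
    forall B, V B -> forall b : nat -> B, holds_all b phi -> holds_all b gam -> holds b d.
Proof.
move=> HV H; apply: contrapT => HN.
have [L HL|N [TN [v Hv]]] := @compactness (ThV V) nat (fun f a => a = id /\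
    (f = fneg (feqn d) \/ f = eqns_form gam \/ exists e, S e /\ f = feqn e)).
  have [phi [Hphi HphiL]] : exists phi : list eqn, (forall e, List.In e phi -> S e) /\
      forall (B : struct) (b : nat -> B), holds_all b phi -> holds_all b gam -> ~ holds b d ->
        forall p, List.In p L -> sat (fun i => b (p.2 i)) p.1.
    elim: L HL => [|[f a] L IH] HL; first by exists nil.
    have [phi [H1 H2]] : exists phi : list eqn, (forall e, List.In e phi -> S e) /\
      forall (B : struct) (b : nat -> B), holds_all b phi -> holds_all b gam -> ~ holds b d ->
        forall p, List.In p L -> sat (fun i => b (p.2 i)) p.1.
      by apply: IH => p Hp; apply: HL; right.
    have [/= -> Hf] := HL (f, a) (or_introl erefl).
    case: Hf => [->|[->|[e [Se ->]]]].
    + by exists phi; split=> // B b h1 h2 h3 p [<- //|]; apply: H2.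
    + exists phi; split=> // B b h1 h2 h3 p [<- //|]; last exact: H2.
      exact/sat_eqns_form.
    + exists (e :: phi)%list; split=> [e' [<- //|]|B b /holds_all_cons[h0 h1] h2 h3 p [<- //|]]; last exact: H2.
      exact: H1.
  apply: contrapT => HN'; apply: HN; exists phi; split=> // B VB b h1 h2; apply: contrapT => h3.
  apply: HN'; exists B; split; first exact/model_ThV.
  by exists b; apply: HphiL.
have VN : V N by apply/(model_ThV N HV).
have E f (Hf : f = fneg (feqn d) \/ f = eqns_form gam \/ exists e, S e /\ f = feqn e) :
  sat v f by apply: (Hv f id).
apply: (E (fneg (feqn d)) (or_introl erefl)).
apply: (H N VN v) => [e Se|]; first by apply: (E (feqn e)); right; right; exists e.
by apply/sat_eqns_form; apply: E; right; left.
Qed.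

(** * Solvability of equations and negated equations in extensions *)

Definition lits (A : struct) (a : nat -> A) (d : list eqn * list eqn) : Prop :=
  holds_all a d.1 /\ forall e, List.In e d.2 -> ~ holds a e.

Definition extends (V : struct -> Prop) (y : nat) (Phi : forall A : struct, (nat -> A) -> Prop)
    (A : struct) (a : nat -> A) : Prop :=
  exists (B : struct) (l : A -> B) (b : B), V B /\ embedding l /\ Phi B (upd (fun i => l (a i)) y b).
Arguments extends V y Phi {A} a.

Lemma upd_id (A : Type) (a : nat -> A) y x i : i != y -> upd a y x i = a i.
Proof. by rewrite /upd => /negbTE->. Qed.

(** Negated equations can be refuted one at a time: in a product of two extensions [gam] holds
    because it holds in both factors, while an equation fails as soon as it fails in one. *)
Lemma extends_lits_join V y gam (del : list eqn) (A : struct) (a : nat -> A) :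
  eq_class V -> extends V y (fun B b => holds_all b gam) a ->
  (forall d, List.In d del -> extends V y (fun B b => holds_all b gam /\ ~ holds b d) a) ->
  extends V y (fun B b => lits b (gam, del)) a.
Proof.
move=> HV; elim: del => [|d del IH] H0 H.
  by case: H0 => B [l [b [VB [Hl Hb]]]]; exists B, l, b; split=> //; split=> //; split.
have [B1 [l1 [b1 [V1 [L1 [g1 d1]]]]]] : extends V y (fun B b => lits b (gam, del)) a.
  by apply: IH => // e He; apply: H; right.
have [B2 [l2 [b2 [V2 [L2 [g2 d2]]]]]] := H d (or_introl erefl).
pose C (i : bool) := if i then B1 else B2.
pose l (i : bool) : A -> C i := match i with true => l1 | false => l2 end.
pose b : prod_struct C := fun i => match i return C i with true => b1 | false => b2 end.
pose L : A -> prod_struct C := fun x i => l i x.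
have E e : holds (upd (fun n => L (a n)) y b) e <->
    holds (upd (fun n => l1 (a n)) y b1) e /\ holds (upd (fun n => l2 (a n)) y b2) e.
  have X i : (fun n => upd (fun n => L (a n)) y b n i) = upd (fun n => l i (a n)) y (b i).
    by rewrite -(upd_comp (fun z : prod_struct C => z i)).
  rewrite holds_prod; split=> [H'|[h1 h2] []]; rewrite ?X //.
  by split; [have := H' true|have := H' false]; rewrite X.
exists (prod_struct C), L, b; split; first by apply: class_prod => // -[].
split.
  apply: (@pairing_emb bool C A l true) => //; case; [exact: L1.1|exact: L2.1].
split=> [e He|e [<-|He]]; first by apply/E; split; [exact: g1|exact: g2].
- by case/E.
- by case/E => /(d1 _ He).
Qed.

Lemma extension_criterion V : eq_class V -> coherent V -> EDPC V -> AP V -> ERVP V ->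
  forall y gam del, exists chi, qfree chi /\
    (forall A, V A -> forall a : nat -> A, sat a chi -> extends V y (fun B b => lits b (gam, del)) a) /\
    (forall A, V A -> forall (a : nat -> A) b, lits (upd a y b) (gam, del) -> sat a chi).
Proof.
move=> HV HC HE HAP HR y gam del.
have [n0 Hn0] := eqns_bound (gam ++ del)%list.
pose n := maxn n0 y.+1.
have yn : y < n by rewrite leq_max leqnn orbT.
have [Hgam Hdel] : eqns_vars_in (fun i => i < n) gam /\ eqns_vars_in (fun i => i < n) del.
  apply/eqns_vars_in_app; apply: eqns_vars_in_sub Hn0 _ => i Hi; by rewrite leq_max Hi.
have [Pi [HPi [Pi1 Pi2]]] := coherent_restriction HV HC y Hgam.
pose xs := seq.filter (fun i => i != y) (iota 0 n).
have xsE i : (i \in xs) = (i < n) && (i != y) by rewrite mem_filter mem_iota add0n andbC.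
(* [pi] restricts to the variables other than [y] the system [th] that expresses the implication
   from [gam] to [d]. *)
have Hpi d : exists pi : option (list eqn), List.In d del ->
    (forall A, V A -> forall (a : nat -> A) b, holds_opt a pi -> holds_all (upd a y b) gam ->
       holds (upd a y b) d) /\
    (forall phi, eqns_vars_in (fun i => (i < n) && (i != y)) phi ->
       (forall B, V B -> forall b : nat -> B, holds_all b phi -> holds_all b gam -> holds b d) ->
       forall A, V A -> forall a : nat -> A, holds_all a phi -> holds_opt a pi).
  case: (EM (List.In d del)) => [Hd|]; last by exists None.
  have [th [th1 th2]] := edpc_deduction HV HE gam (d :: nil)%list.
  have [||pi [p1 [p2 p3]]] := HR xs y th; first by rewrite xsE eqxx andbF.
    apply: (@eqns_vars_in_sub (fun i => i < n)).
      by apply: th1 => // e [<-|//]; apply: Hdel.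
    by move=> i Hi; rewrite inE xsE Hi /= orbN.
  exists pi => _; split.
    move=> A VA a b Ha Hb.
    have Ha' : holds_opt (upd a y b) pi.
      case: pi Ha p1 {p2 p3} => //= E HE' /(_ E erefl) HEv.
      apply: eq_holds_all HEv _ HE' => i; rewrite xsE => /andP[_ iy]; by rewrite upd_id.
    have := p2 A VA _ Ha'; move/th2 => /(_ VA A VA id (@id_emb A).1 Hb); apply; by left.
  move=> phi Hphi Hd' A VA a Ha; apply: p3 VA _ Ha.
    by apply: eqns_vars_in_sub Hphi _ => i; rewrite xsE.
  move=> B VB b Hb; apply/th2 => // D VD h Hh Hg e [<-|//].
  by apply: Hd' => //; apply: holds_all_hom.
have [pi {}Hpi] := choice Hpi.
pose npi d := match pi d with Some E => fneg (eqns_form E) | None => fverum end.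
have npiE (A : struct) (a : nat -> A) d : sat a (npi d) <-> ~ holds_opt a (pi d).
  rewrite /npi; case: (pi d) => [E|] /=; last by split=> // _ [].
  by rewrite sat_eqns_form.
exists (fand (eqns_form Pi) (fconj (List.map npi del))).
have chiE (A : struct) (a : nat -> A) : sat a (fand (eqns_form Pi) (fconj (List.map npi del))) <->
    holds_all a Pi /\ forall d, List.In d del -> ~ holds_opt a (pi d).
  rewrite /= sat_eqns_form sat_fconj; split=> -[H1 H2]; split=> // d.
    by move=> Hd; apply/npiE/H2/List.in_map.
  by case/List.in_map_iff => d' [<- /H2]; rewrite npiE.
split.
  rewrite /= qfree_eqns_form /=; apply: qfree_fconj => f /List.in_map_iff[d [<- _]].
  by rewrite /npi; case: (pi d) => //= E; apply: qfree_eqns_form.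
split=> A VA a; last first.
  move=> b [Hg Hd]; apply/chiE; split.
    apply: eq_holds_all HPi _ (Pi1 A VA _ Hg) => i /andP[_]; exact: upd_id.
  move=> d Hdd Hpd; have [p1 _] := Hpi d Hdd.
  exact: (Hd d Hdd (p1 A VA a b Hpd Hg)).
case/chiE => HPa Hnpi.
(* The equations alone: [Pi] gives a homomorphism from [Q], and [transfer] turns the generic
   solution in [P] into one over [A]. *)
have base : extends V y (fun B b => holds_all b gam) a.
  have [P [Q [j [k [p [q [VP [VQ [Hj [Hk [Hp Hq]]]]]]]]]]] := Pi2 A VA a HPa.
  have [B [i [l [VB [Hi [Hl E]]]]]] := transfer HV HE HAP VQ VP VA Hj Hk.
  exists B, l, (i (p y)); split=> //; split=> //.
  have := holds_all_hom Hi Hp; apply: eq_holds_all Hgam _ => m Hm.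
  rewrite /upd; case: eqP => [-> //|/eqP my].
  by have [e1 e2] := Hq m Hm my; rewrite -e1 E e2.
(* Suppose that every solution of [gam] over [A] satisfies [d]. It is shown that [pi d] then holds
   at [a], against [chi]. *)
apply: extends_lits_join => // d Hd; apply: contrapT => HN.
have {}HN (B : struct) (l : A -> B) b : V B -> embedding l -> holds_all (upd (fun i => l (a i)) y b) gam ->
    holds (upd (fun i => l (a i)) y b) d.
  by move=> VB Hl Hg; apply: contrapT => Hnd; apply: HN; exists B, l, b.
apply: (Hnpi d Hd); have [_ p4] := Hpi d Hd.
(* [F] carries a generic solution of [gam] subject to the equations in the other variables that are
   true of [a]. *)
pose S e := all (fun i => (i < n) && (i != y)) (evars e) /\ holds a e.
have [F [VF [v [v1 v2]]]] := @exact_model V nat (fun e a => a = id /\ (S e \/ List.In e gam)) HV.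
have vS e : S e -> holds v e by move=> Se; apply: (v1 e id); split=> //; left.
have vg : holds_all v gam by move=> e He; apply: (v1 e id); split=> //; right.
have {}v2 e : holds v e -> forall B, V B -> forall b : nat -> B, (forall e, S e -> holds b e) ->
    holds_all b gam -> holds b e.
  by move=> He B VB b H1 H2; apply: (v2 e id He B VB b) => e' a' [-> []]; [apply: H1|apply: H2].
pose sg := upd tvar y tone.
have sgE (C : struct) (c : nat -> C) t : eval c (tsub sg t) = eval (upd c y (s_one C)) t.
  by rewrite eval_tsub; congr eval; apply/funext => i; rewrite /sg /upd; case: eqP.
have sgv t : all (fun i => i < n) (tvars t) -> all (fun i => (i < n) && (i != y)) (tvars (tsub sg t)).
  move=> Ht; rewrite tvars_tsub; apply: sub_all Ht => i Hi.
  by rewrite /sg /upd; case: (eqVneq i y) => //= iy; rewrite Hi iy.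
pose a0 := upd a y (s_one A).
(* The subalgebra generated by [a] embeds in [F]: an equation that follows from [S] and [gam] holds
   in the extension provided by [base], hence already in [A]. *)
have [|k [Hk kE]] := @sub_lift_emb A F n a0 (upd v y (s_one F)).
  move=> s t Hs Ht; rewrite -!sgE; pose e := (tsub sg s, tsub sg t).
  have He : all (fun i => (i < n) && (i != y)) (evars e) by rewrite all_cat /= !sgv.
  split=> H; first by apply: (vS e).
  have [B [l [b [VB [Hl Hb]]]]] := base.
  have He' (c : eqn) : all (fun i => (i < n) && (i != y)) (evars c) ->
      holds (upd (fun i => l (a i)) y b) c <-> holds a c.
    move=> Hc; rewrite -(holds_emb a c Hl); split; apply: (eq_holds Hc) => i /andP[_ iy];
      by rewrite upd_id.
  apply/(He' e He); apply: (v2 e H B VB) => // c [Hc1 Hc2]; exact/He'.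
have [g Hg] := sub_gens n a0.
have [D [h1 [h2 [VD [Hh1 [Hh2 E]]]]]] :=
  HAP _ A F (class_sub n a0 HV VA) VA VF _ _ (sub_emb n a0) Hk.
have Eag i : i < n -> h2 (v i) = upd (fun i => h1 (a i)) y (h2 (v y)) i.
  move=> Hi; rewrite /upd; case: (eqVneq i y) => [-> //|iy].
  have -> : a i = sval (g i) by rewrite Hg // /a0 upd_id.
  rewrite E (kE (tvar i)) /= ?Hi ?upd_id //; exact: Hg.
(* The amalgam extends [A] and contains the generic solution, so [d] holds there and hence at [v] in
   [F]. Thus [d] follows from [gam] and finitely many equations of [S], and these imply [pi d]. *)
have vd : holds v d.
  apply/(holds_emb v d Hh2).
  have Hdv : all (fun i => i < n) (evars d) by move/eqns_vars_inP: Hdel; apply.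
  apply: (@eq_holds _ _ (upd (fun i => h1 (a i)) y (h2 (v y))) _ d Hdv) => [i Hi|].
    by rewrite -Eag.
  apply: HN => //; apply: eq_holds_all Hgam Eag _.
  exact: holds_all_hom Hh2.1 vg.
have [phi [HS Hphi]] := finite_consequence HV (v2 d vd).
apply: (p4 phi) => //; last by move=> e /HS[].
by apply/eqns_vars_inP => e /HS[].
Qed.

(** Disjunctive normal form with a polarity flag: [true] treats the formula and [false] its
    negation. Each pair lists the equations and the negated equations of one disjunct. *)
Fixpoint dnf (b : bool) (f : form) : list (list eqn * list eqn) :=
  let cross l m := List.flat_map (fun d => List.map (fun d' => (d.1 ++ d'.1, d.2 ++ d'.2)%list) m) l in
  match f with
  | fbot => if b then nil else ((nil, nil) :: nil)%list
  | feq u v => if b then (((u, v) :: nil, nil) :: nil)%list else ((nil, (u, v) :: nil) :: nil)%list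
  | fneg g => dnf (~~ b) g
  | fand g h => if b then cross (dnf true g) (dnf true h) else (dnf false g ++ dnf false h)%list
  | for_ g h => if b then (dnf true g ++ dnf true h)%list else cross (dnf false g) (dnf false h)
  | fimp g h => if b then (dnf false g ++ dnf true h)%list else cross (dnf true g) (dnf false h)
  | fall _ _ | fex _ _ => nil
  end.

Lemma sat_dnf (A : struct) (a : nat -> A) f : qfree f -> forall b,
  (exists d, List.In d (dnf b f) /\ lits a d) <-> (if b then sat a f else ~ sat a f).
Proof.
have C l m : (exists d, List.In d (List.flat_map (fun d => List.map (fun d' => (d.1 ++ d'.1, d.2 ++ d'.2)%list) m) l) /\ lits a d) <->
   (exists d, List.In d l /\ lits a d) /\ (exists d, List.In d m /\ lits a d).
  split=> [[d [/List.in_flat_map[d1 [h1 /List.in_map_iff[d2 [<- h2]]]] [/holds_all_app[g1 g2] g3]]]|].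
    split; [exists d1|exists d2]; split=> //; split=> // e He; apply: g3;
      by apply/List.in_app_iff; auto.
  move=> [[d1 [h1 [g1 g1']]] [d2 [h2 [g2 g2']]]].
  exists (d1.1 ++ d2.1, d1.2 ++ d2.2)%list; split.
    apply/List.in_flat_map; exists d1; split=> //.
    exact: (List.in_map (fun d' => (d1.1 ++ d'.1, d1.2 ++ d'.2)%list)).
  by split; [apply/holds_all_app|move=> e /List.in_app_iff[/g1'|/g2']].
have D l m : (exists d, List.In d (l ++ m)%list /\ lits a d) <->
   (exists d, List.In d l /\ lits a d) \/ (exists d, List.In d m /\ lits a d).
  split=> [[d [/List.in_app_iff[h|h] H]]|[[d [h H]]|[d [h H]]]].
  - by left; exists d.
  - by right; exists d.
  - by exists d; split=> //; apply/List.in_app_iff; left.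
  - by exists d; split=> //; apply/List.in_app_iff; right.
elim: f => //= [_|u v _|g IH Hg|g IHg h IHh|g IHg h IHh|g IHg h IHh] b.
- case: b; first by split=> // -[d []].
  by split=> [_ []|_]; exists (nil, nil); split; [left|split].
- case: b; split=> [[d [[<-|//] [H1 H2]]]|H].
  + by apply: (H1 (u, v)); left.
  + by exists ((u, v) :: nil, nil)%list; split; [left|split=> // e [<-|]].
  + by apply: (H2 (u, v)); left.
  + by exists (nil, (u, v) :: nil)%list; split; [left|split=> // e [<-|]].
- by rewrite IH //; case: b => //=; rewrite not_notP.
all: case/andP: b => Hg Hh b; have := IHg Hg true; have := IHg Hg false;
  have := IHh Hh true; have := IHh Hh false => /= h1 h2 h3 h4;
  case: b; rewrite ?C ?D ?h1 ?h2 ?h3 ?h4.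
all: by have [?|?] := EM (sat a g); have [?|?] := EM (sat a h); intuition.
Qed.

(** * The completion *)

Section Substructure.
Variables (A : struct) (P : A -> Prop).
Hypothesis P2 : forall op : A -> A -> A,
  (op = s_meet \/ op = s_join \/ op = s_mul \/ op = s_ldiv \/ op = s_rdiv) ->
  forall x y, P x -> P y -> P (op x y).
Hypothesis P1 : P (s_one A).
Hypothesis P0 : P (s_zero A).

Definition sub_op op Hop (x y : {x | P x}) : {x | P x} :=
  exist P _ (@P2 op Hop (sval x) (sval y) (svalP x) (svalP y)).

Definition substruct : struct := @Struct {x | P x}
  (sub_op (or_introl erefl)) (sub_op (or_intror (or_introl erefl)))
  (sub_op (or_intror (or_intror (or_introl erefl))))
  (sub_op (or_intror (or_intror (or_intror (or_introl erefl)))))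
  (sub_op (or_intror (or_intror (or_intror (or_intror erefl)))))
  (exist P _ P1) (exist P _ P0).

Lemma substruct_emb : embedding (fun x : substruct => sval x).
Proof. by split=> // -[x hx] [y hy] /= e; apply: eq_exist. Qed.
End Substructure.

(** The limit is a quotient of a substructure of the product, namely the eventually coherent
    sequences modulo eventual equality, so it stays in [V]. *)
Lemma direct_limit V (C : nat -> struct) (l : forall n, C n -> C n.+1) :
  eq_class V -> (forall n, V (C n)) -> (forall n, embedding (l n)) ->
  exists (D : struct) (i : forall n, C n -> D), V D /\ (forall n, embedding (i n)) /\
    (forall n x, i n.+1 (l n x) = i n x) /\ forall x, exists n y, x = i n y.
Proof.
move=> HV VC Hl.
pose coh n (s : prod_struct C) := forall m, n <= m -> s m.+1 = l m (s m).
pose P s := exists n, coh n s.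
have cohS n m s : n <= m -> coh n s -> coh m s by move=> nm H k mk; apply: H; apply: leq_trans mk.
have coh2 (op : forall S : struct, S -> S -> S) n s t :
   (forall n x y, l n (op _ x y) = op _ (l n x) (l n y)) ->
   (forall n, op (prod_struct C) s t n = op (C n) (s n) (t n)) ->
   coh n s -> coh n t -> coh n (op _ s t).
  by move=> lop E Hs Ht m nm; rewrite !E Hs // Ht // lop.
have lmor n := (Hl n).1.
have P2 (op : prod_struct C -> prod_struct C -> prod_struct C) :
  (op = s_meet \/ op = s_join \/ op = s_mul \/ op = s_ldiv \/ op = s_rdiv) ->
  forall x y, P x -> P y -> P (op x y).
  move=> Hop x y [n Hx] [m Hy]; exists (maxn n m).
  have {}Hx := cohS _ _ _ (leq_maxl n m) Hx; have {}Hy := cohS _ _ _ (leq_maxr n m) Hy.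
  case: Hop => [->|[->|[->|[->|->]]]];
    [apply: (coh2 (@s_meet))|apply: (coh2 (@s_join))|apply: (coh2 (@s_mul))
    |apply: (coh2 (@s_ldiv))|apply: (coh2 (@s_rdiv))] => // k u v;
    by case: (lmor k) => [? [? [? [? []]]]].
have P1 : P (s_one (prod_struct C)).
  by exists 0 => m _ /=; case: (lmor m) => [? [? [? [? [? []]]]]].
have P0 : P (s_zero (prod_struct C)).
  by exists 0 => m _ /=; case: (lmor m) => [? [? [? [? [? []]]]]].
pose W := substruct P2 P1 P0.
pose th (s t : W) := exists n, forall m, n <= m -> sval s m = sval t m.
have Hth : congruence th.
  split=> [s|]; first by exists 0.
  split=> [s t [n H]|]; first by exists n => m /H.
  split=> [s t u [n H] [n' H']|op Hop s s' t t' [n H] [n' H']].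
    by exists (maxn n n') => m; rewrite geq_max => /andP[/H -> /H' ->].
  exists (maxn n n') => m; rewrite geq_max => /andP[/H e /H' e'].
  by case: Hop => [->|[->|[->|[->|->]]]] /=; rewrite e e'.
have ext : forall n (x : C n), exists s : W, coh n (sval s) /\ sval s n = x.
  (* The chain is generalised so that the induction on [n] can drop its first term; entries before
     stage [n] are filled with units. *)
  suff ext0 n : forall (C' : nat -> struct) (l' : forall n, C' n -> C' n.+1) (x : C' n),
      exists s : forall m, C' m, (forall m, n <= m -> s m.+1 = l' m (s m)) /\ s n = x.
    move=> n x; have [s [Hs sx]] := ext0 n C l x.
    by exists (exist P s (ex_intro _ n Hs)).
  elim: n => [|n IH] C' l' x.
    exists (fix s m : C' m := match m return C' m with 0 => x | m.+1 => l' m (s m) end).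
    by split.
  have [s [Hs sx]] := IH (fun m => C' m.+1) (fun m => l' m.+1) x.
  exists (fun m => match m return C' m with 0 => s_one _ | m.+1 => s m end); split=> // -[|m] //.
  exact: Hs.
have agree n (s t : W) : coh n (sval s) -> coh n (sval t) -> sval s n = sval t n -> th s t.
  move=> Hs Ht e; exists n => m; elim: m => [|m IH]; first by rewrite leqn0 => /eqP n0; move: e; rewrite n0.
  rewrite leq_eqVlt => /orP[/eqP <- //|]; rewrite ltnS => nm.
  by rewrite Hs // Ht // IH.
have [i Hi] := dependent_choice (fun n => dependent_choice (ext n)).
have Dq := qcl_hom Hth.
pose D := quot Hth; pose j n (x : C n) : D := qcl Hth (i n x).
have VW : V W := class_emb HV (substruct_emb P2 P1 P0) (class_prod HV VC).
exists D, j; split; first by apply: class_quot.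
split; last split.
- move=> n; split; last first.
    move=> x y /qclE[m Hm]; move: (Hi n x) (Hi n y) => [cx ex] [cy ey].
    have : sval (i n x) (maxn m n) = sval (i n y) (maxn m n) by apply: Hm; rewrite leq_maxl.
    rewrite -(subnKC (leq_maxr m n)); elim: (maxn m n - n) => [|k IH].
      by rewrite addn0 ex ey.
    rewrite addnS cx ?leq_addr // cy ?leq_addr //.
    by move/(Hl (n + k)).2; apply: IH.
  have opE (op : forall S : struct, S -> S -> S) (x y : C n) :
     (forall n x y, l n (op _ x y) = op _ (l n x) (l n y)) ->
     (forall s t : W, sval (op _ s t) = op _ (sval s) (sval t)) ->
     (forall s t n, op (prod_struct C) s t n = op (C n) (s n) (t n)) ->
     (forall s t : W, qcl Hth (op _ s t) = op D (qcl Hth s) (qcl Hth t)) ->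
     j n (op _ x y) = op D (j n x) (j n y).
    move=> lop e1 e2 e3; rewrite /j -e3; apply/qclE/(agree n); first exact: (Hi n _).1.
      rewrite e1; apply: coh2 => //; exact: (Hi n _).1.
    by rewrite e1 e2 !(Hi n _).2.
  have [q1 [q2 [q3 [q4 [q5 [q6 q7]]]]]] := Dq.
  split=> [x y|]; first by apply: (opE (@s_meet)) => // k u v; case: (lmor k).
  split=> [x y|]; first by apply: (opE (@s_join)) => // k u v; case: (lmor k) => [? []].
  split=> [x y|]; first by apply: (opE (@s_mul)) => // k u v; case: (lmor k) => [? [? []]].
  split=> [x y|]; first by apply: (opE (@s_ldiv)) => // k u v; case: (lmor k) => [? [? [? []]]].
  split=> [x y|]; first by apply: (opE (@s_rdiv)) => // k u v; case: (lmor k) => [? [? [? [? []]]]].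
  split.
    rewrite -q6; apply/qclE/(agree n); [exact: (Hi n _).1| |by rewrite (Hi n _).2].
    by move=> m _ /=; case: (lmor m) => [? [? [? [? [? []]]]]].
  rewrite -q7; apply/qclE/(agree n); [exact: (Hi n _).1| |by rewrite (Hi n _).2].
  by move=> m _ /=; case: (lmor m) => [? [? [? [? [? []]]]]].
- move=> n x; apply/qclE/(agree n.+1); first exact: (Hi n.+1 _).1.
    by apply: cohS (Hi n x).1.
  by rewrite (Hi n.+1 _).2 (Hi n x).1 // (Hi n x).2.
move=> x; rewrite -(qcl_sval x); have [n Hn] := svalP (sval x).
exists n, (sval (sval x) n); apply/qclE/(agree n) => //; first exact: (Hi n _).1.
by rewrite (Hi n _).2.
Qed.

(** [chi] guarantees a solution of [psi] in some extension within [V]. The completion demands that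
    such a solution exist in the model itself. *)
Definition witnesses (V : struct -> Prop) y (psi chi : form) : Prop :=
  qfree psi /\ qfree chi /\ forall A, V A -> forall a : nat -> A, sat a chi ->
    extends V y (fun B b => sat b psi) a.

(** Finitely many demands are met by successive extensions, since a quantifier-free [chi] stays true
    in extensions; compactness meets all of them at once. *)
Lemma witness_extension V (A : struct) : eq_class V -> V A ->
  exists B, V B /\ exists l : A -> B, embedding l /\
    forall y psi chi, witnesses V y psi chi -> forall a : nat -> A, sat a chi ->
      exists b, sat (upd (fun i => l (a i)) y b) psi.
Proof.
move=> HV VA.
pose good (t : nat * form * (nat -> A)) := exists chi, witnesses V t.1.1 t.1.2 chi /\ sat t.2 chi.
pose task := {t | good t}.
have fin (ts : list task) : exists B, V B /\ exists l : A -> B, embedding l /\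
    forall t, List.In t ts -> exists b, sat (upd (fun i => l ((sval t).2 i)) (sval t).1.1 b) (sval t).1.2.
  elim: ts => [|[[[y psi] a] [chi [Hw Ha]]] ts [B [VB [l [Hl H]]]]].
    by exists A; split=> //; exists id; split.
  have [/= Hw' Ha0] := (Hw, Ha).
  have Ha' : sat (fun i => l (a i)) chi by apply/(sat_qf_emb a Hl) => //; case: Hw' => _ [].
  have [B' [l' [b' [VB' [Hl' Hb']]]]] := Hw'.2.2 B VB _ Ha'.
  exists B'; split=> //; exists (fun x => l' (l x)); split; first exact: emb_comp.
  move=> t [<-|Ht]; first by exists b'.
  have [b Hb] := H t Ht; exists (l' b).
  rewrite (upd_comp l'); apply/(sat_qf_emb _ Hl') => //.
  by case: (svalP t) => chi' [[]].
(* Besides the elements of [A] there is one new constant for each task, naming its solution. *)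
pose X := (A + task)%type.
have [L HL|N [TN [v Hv]]] := @compactness (ThV V) X (fun f a =>
   (exists a0, a = (fun i => inl (a0 i)) /\ qfree f /\ sat a0 f) \/
   (exists t : task, a = upd (fun i => inl ((sval t).2 i)) (sval t).1.1 (inr t) /\ f = (sval t).1.2)).
  have [ts Hts] : exists ts : list task, forall p, List.In p L ->
     (exists a0, p.2 = (fun i => inl (a0 i)) /\ qfree p.1 /\ sat a0 p.1) \/
     (exists t : task, List.In t ts /\ p.2 = upd (fun i => inl ((sval t).2 i)) (sval t).1.1 (inr t) /\ p.1 = (sval t).1.2).
    elim: L HL => [|p L IH] HL; first by exists nil.
    have [|ts Hts] := IH; first by move=> q Hq; apply: HL; right.
    case: (HL p (or_introl erefl)) => [Hp|[t Ht]].
      by exists ts => q [<-|/Hts //]; left.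
    exists (t :: ts)%list => q [<-|/Hts[]]; [right; exists t; split=> //; by left|by left|].
    by move=> [t' [H1 H2]]; right; exists t'; split=> //; right.
  have [B [VB [l [Hl Hb]]]] := fin ts.
  have Hb' (t : task) : exists b, List.In t ts -> sat (upd (fun i => l ((sval t).2 i)) (sval t).1.1 b) (sval t).1.2.
    case: (EM (List.In t ts)) => [/Hb[b H]|H]; first by exists b.
    by exists (s_one B).
  have [w Hw] := choice Hb'.
  exists B; split; first exact/model_ThV.
  exists (fun x : X => match x with inl x => l x | inr t => w t end) => p /Hts[[a0 [-> [Hf Hs]]]|[t [Ht [-> ->]]]].
    exact/(sat_qf_emb a0 Hl).
  move: (Hw t Ht); congr sat; apply/funext => i; by rewrite /upd; case: eqP.
exists N; split; first exact/(model_ThV N HV).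
exists (fun x => v (inl x)); split.
  apply: diagram_embedding => f a Hf Ha.
  by apply: (Hv f (fun i => inl (a i))); left; exists a.
move=> y psi chi Hw a Ha.
have G : good (y, psi, a) by exists chi.
exists (v (inr (exist _ _ G))).
rewrite (upd_comp (fun x => v x) (fun i => inl (a i))).
by apply: Hv; right; exists (exist _ _ G).
Qed.

Definition completion V : theory := fun f => ThV V f \/
  exists y psi chi, witnesses V y psi chi /\ f = fclose (fimp chi (fex y psi)).

Lemma model_completionP V M : eq_class V -> model (completion V) M <->
  V M /\ forall y psi chi, witnesses V y psi chi -> forall a : nat -> M, sat a chi ->
     exists b, sat (upd a y b) psi.
Proof.
move=> HV; split=> [H|[VM H] f [Hf|[y [psi [chi [Hw ->]]]]]].
- split; first by apply/(model_ThV M HV) => f Hf; apply: H; left.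
  move=> y psi chi Hw; apply: (proj1 (sat_fclose M (fimp chi (fex y psi)))).
  by apply: H; right; exists y, psi, chi.
- exact: ((model_ThV M HV).2 VM f Hf).
- by apply/sat_fclose => a; apply: H Hw a.
Qed.

(** The limit of a chain in which each stage solves the demands of the previous one. A demand on the
    limit involves finitely many parameters, so it already arises at some stage. *)
Lemma completion_extension V A : eq_class V -> V A ->
  exists D, model (completion V) D /\ exists l : A -> D, embedding l.
Proof.
move=> HV VA.
pose VT := {B : struct | V B}.
have step (B : VT) : exists B' : VT, exists l : sval B -> sval B', embedding l /\
    forall y psi chi, witnesses V y psi chi -> forall a : nat -> sval B, sat a chi ->
      exists b, sat (upd (fun i => l (a i)) y b) psi.
  have [B' [VB' [l Hl]]] := witness_extension HV (svalP B).
  by exists (exist _ B' VB'), l.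
have [nx Hnx] := choice step.
have [l Hl] := dependent_choice Hnx.
pose C n := iter n nx (exist _ A VA).
have VC n : V (sval (C n)) := svalP (C n).
have [D [i [VD [Hi [il iD]]]]] := direct_limit HV VC (fun n => (Hl (C n)).1).
exists D; split; last by exists (i 0); exact: (Hi 0).
apply/model_completionP => //; split=> // y psi chi Hw a Ha.
have lift_ge n (x : sval (C n)) m : n <= m -> exists x' : sval (C m), i m x' = i n x.
  move/subnKC <-; elim: (m - n) => [|d [x' <-]]; first by rewrite addn0; exists x.
  by rewrite addnS; exists (l (C (n + d)) x'); rewrite il.
have [N HN] := ltn_bound (fv chi ++ fv psi).
have [m [a' Ha']] : exists m (a' : nat -> sval (C m)), forall j, j < N -> i m (a' j) = a j.
  elim: N {HN} => [|N [m [a' IH]]]; first by exists 0, (fun _ => s_one _).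
  have [n [x ax]] := iD (a N).
  pose M := maxn m n.
  have H j : exists z : sval (C M), j < N.+1 -> i M z = a j.
    case: (ltngtP j N) => [jN|jN|->].
    - have [z Hz] := lift_ge m (a' j) M (leq_maxl _ _).
      by exists z => _; rewrite Hz IH.
    - by exists (s_one _); rewrite ltnS leqNgt jN.
    - by have [z Hz] := lift_ge n x M (leq_maxr _ _); exists z => _; rewrite Hz ax.
  by have [b Hb] := choice H; exists M, b.
have H1 : sat a' chi.
  apply/(sat_qf_emb a' (Hi m)); first by case: Hw => _ [].
  apply: (proj1 (eq_sat _)) Ha => j Hj; rewrite Ha' //.
  by move/allP: HN; apply; rewrite mem_cat Hj.
have [b Hb] := (Hl (C m)).2 y psi chi Hw a' H1.
exists (i m.+1 b); apply: (proj1 (eq_sat _)) (proj2 (sat_qf_emb _ (Hi m.+1) Hw.1) Hb) => j Hj.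
rewrite /upd; case: eqP => // _; rewrite il Ha' //.
by move/allP: HN; apply; rewrite mem_cat Hj orbT.
Qed.

(** To eliminate one existential quantifier, take the disjunction of the extension criteria over the
    disjunctive normal form. A solution in the model implies it by the criterion; conversely, it
    forms with [psi] a pair in [witnesses], so an axiom supplies the solution. *)
Lemma completion_qe V : eq_class V -> coherent V -> EDPC V -> AP V -> ERVP V ->
  forall f, exists chi, qfree chi /\
    forall M, model (completion V) M -> forall a : nat -> M, sat a f <-> sat a chi.
Proof.
move=> HV HC HE HAP HR.
have ex y psi : qfree psi -> exists chi, qfree chi /\
    forall M, model (completion V) M -> forall a : nat -> M, sat a (fex y psi) <-> sat a chi.
  move=> Hpsi.
  have [X HX] := choice (fun d : list eqn * list eqn => extension_criterion HV HC HE HAP HR y d.1 d.2).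
  have Q : qfree (fdisj (List.map X (dnf true psi))).
    by apply: qfree_fdisj => f /List.in_map_iff[d [<- _]]; apply: (HX d).1.
  exists (fdisj (List.map X (dnf true psi))); split=> // M /(model_completionP M HV)[VM HM] a.
  rewrite sat_fdisj /=; split.
    move=> [b /(sat_dnf _ Hpsi true)[d [Hd Hb]]].
    exists (X d); split; first exact: List.in_map.
    exact: (HX d).2.2 M VM a b Hb.
  move=> [f [Hf Ha]]; apply: (HM y psi (fdisj (List.map X (dnf true psi)))); last by apply/sat_fdisj; exists f.
  split=> //; split=> // A VA a' /sat_fdisj[g [/List.in_map_iff[d [<- Hd]] Hg]].
  have [B [l [b [VB [Hl Hb]]]]] := (HX d).2.1 A VA a' Hg.
  exists B, l, b; split=> //; split=> //; by apply/(sat_dnf _ Hpsi true); exists d.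
elim=> [|u v|g [c [Qc Hc]]|g [c [Qc Hc]] h [d [Qd Hd]]|g [c [Qc Hc]] h [d [Qd Hd]]|g [c [Qc Hc]] h [d [Qd Hd]]|n g [c [Qc Hc]]|n g [c [Qc Hc]]].
- by exists fbot.
- by exists (feq u v).
- by exists (fneg c); split=> // M HM a /=; rewrite (Hc M HM).
- by exists (fand c d); split=> [|M HM a]; rewrite /= ?Qc // (Hc M HM) (Hd M HM).
- by exists (for_ c d); split=> [|M HM a]; rewrite /= ?Qc // (Hc M HM) (Hd M HM).
- by exists (fimp c d); split=> [|M HM a]; rewrite /= ?Qc // (Hc M HM) (Hd M HM).
- have [e [Qe He]] := ex n (fneg c) Qc.
  exists (fneg e); split=> // M HM a /=; rewrite -(He M HM) /=; split.
    by move=> H [x]; apply; apply/(Hc M HM)/H.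
  by move=> H x; apply: contrapT => Hx; apply: H; exists x => /(Hc M HM).
- have [e [Qe He]] := ex n c Qc.
  exists e; split=> // M HM a; rewrite -(He M HM) /=.
  by split=> -[x Hx]; exists x; apply/(Hc M HM).
Qed.

Lemma universal_down (A B : struct) (h : A -> B) f : embedding h -> universal f ->
  (forall b : nat -> B, sat b f) -> forall a : nat -> A, sat a f.
Proof.
move=> Hh Hf H a; have := H (fun i => h (a i)).
elim: f Hf a {H} => [|u v|g IH|g IHg g' IHg'|g IHg g' IHg'|g IHg g' IHg'|n g IH|n g IH] // Hf a;
  try exact: (proj1 (sat_qf_emb a Hh Hf)).
by move=> H x; apply: IH => //; rewrite -(upd_comp h); apply: H.
Qed.

(** Quantifier-free formulas are absolute along embeddings, so quantifier elimination gives model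
    completeness and completeness over diagrams; embeddability into models of the completion gives
    the same universal consequences. *)
Lemma completion_is_model_completion V :
  eq_class V -> coherent V -> EDPC V -> AP V -> ERVP V -> model_completion (ThV V) (completion V).
Proof.
move=> HV HC HE HAP HR; have QE := completion_qe HV HC HE HAP HR.
split=> [f [[]//|[y [psi [chi [_ ->]]]]]|]; first exact: fclose_sentence.
split=> [M N HM HN h Hh f a|].
  have [c [Qc Hc]] := QE f.
  by rewrite (Hc M HM) (Hc N HN) (sat_qf_emb a Hh Qc).
split=> [f _ Uf|M /(model_ThV M HV) VM f a].
  split=> H M HM a.
    by apply: H => f' Hf'; apply: HM; left.
  move/(model_ThV M HV): HM => VM; have [N [HN [h Hh]]] := completion_extension HV VM.
  by apply: (universal_down Hh Uf) => b; apply: H.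
have [c [Qc Hc]] := QE f.
case: (EM (sat a c)) => Ha; [left|right] => N HN h Hh /=; rewrite (Hc N HN) (sat_qf_emb a Hh Qc) //.
Qed.

(** * Consequences of a model completion *)

Lemma sat_fexs (A : struct) (a : nat -> A) F js :
  sat a (foldr fex F js) <-> exists d, (forall i, i \notin js -> d i = a i) /\ sat d F.
Proof.
elim: js a => [|j js IH] a /=.
  split=> [H|[d [Hd H]]]; first by exists a.
  by have <- : d = a by apply/funext => i; apply: Hd.
split.
  move=> [x /IH[d [Hd H]]]; exists d; split=> // i.
  by rewrite inE negb_or => /andP[ij /Hd ->]; apply: upd_id.
move=> [d [Hd H]]; exists (d j); apply/IH; exists d; split=> // i Hi.
by rewrite /upd; case: (eqVneq i j) => [-> //|ij]; apply: Hd; rewrite inE negb_or ij.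
Qed.

Lemma fv_fexs F js : fv (foldr fex F js) = seq.filter (fun i => i \notin js) (fv F).
Proof.
elim: js => [|j js IH] /=; first by rewrite filter_predT.
by rewrite IH -filter_predI; apply: eq_filter => i /=; rewrite inE negb_or.
Qed.

Lemma mc_model V Ts M : eq_class V -> model_completion (ThV V) Ts -> model Ts M -> V M.
Proof.
move=> HV [_ [_ [HU _]]] HM; have [E HE] := HV; apply/HE => e He.
apply: (proj1 (sat_fclose M (feqn e))).
apply: (proj1 (HU (fclose (feqn e)) (fclose_sentence _) (fclose_universal _))) => // N /(model_ThV N HV) VN.
by apply/sat_fclose; apply: ((HE N).1 VN).
Qed.

(** If a quantifier-free formula true in [A] were satisfied in no model of [Ts], the closure of its
    negation would be a universal consequence of [Ts], hence of [ThV V], and would hold in [A]. *)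
Lemma mc_embed V Ts A : eq_class V -> model_completion (ThV V) Ts -> V A ->
  exists N, model Ts N /\ exists h : A -> N, embedding h.
Proof.
move=> HV [_ [_ [HU _]]] VA; apply: embed_in_model => f a Qf Ha; apply: contrapT => HN.
have H : consequence Ts (fclose (fneg f)).
  move=> N TN; apply/sat_fclose => b Hb; apply: HN; exists N; split=> //; by exists b.
have := proj2 (HU (fclose (fneg f)) (fclose_sentence _) (fclose_universal _)) H A.
move=> /(_ Qf (proj2 (model_ThV A HV) VA)) HA.
exact: ((sat_fclose A (fneg f)).1 HA a Ha).
Qed.

Lemma mc_elem V Ts (A N1 N2 : struct) (h1 : A -> N1) (h2 : A -> N2) f (a : nat -> A) :
  eq_class V -> model_completion (ThV V) Ts -> V A -> model Ts N1 -> model Ts N2 ->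
  embedding h1 -> embedding h2 -> sat (fun i => h1 (a i)) f -> sat (fun i => h2 (a i)) f.
Proof.
move=> HV [_ [_ [_ HD]]] VA T1 T2 E1 E2 H.
have [H'|H'] := HD A (proj2 (model_ThV A HV) VA) f a; first exact: H'.
by case: (H' N1 T1 h1 E1).
Qed.

(** After embedding both algebras in models of [Ts], a finite part of the diagram of [B] is realised
    in [C]: quantify existentially over the parameters outside [A], and transfer the resulting
    formula over [A]. *)
Lemma mc_AP V Ts : eq_class V -> model_completion (ThV V) Ts -> AP V.
Proof.
move=> HV Hmc A B0 C0 VA VB0 VC0 f0 g0 Hf0 Hg0.
have [B [TB [hB HhB]]] := mc_embed HV Hmc VB0; have [C [TC [hC HhC]]] := mc_embed HV Hmc VC0.
pose f x := hB (f0 x); pose g x := hC (g0 x).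
have Hf : embedding f := emb_comp Hf0 HhB; have Hg : embedding g := emb_comp Hg0 HhC.
(* The constants form a disjoint union, and the sentences for [link x] identify the two images of
   each [x] of [A]. *)
pose X := (B + C)%type.
pose link x (i : nat) : X := if i is 0 then inl (f x) else inr (g x).
have [L HL|D [TD [v Hv]]] := @compactness (ThV V) X (fun F a =>
    (exists b, a = (fun i => inl (b i)) /\ qfree F /\ sat b F) \/
    (exists c, a = (fun i => inr (c i)) /\ qfree F /\ sat c F) \/
    (exists x, a = link x /\ F = feq (tvar 0) (tvar 1))).
  have [L1 [lA [H1 H2]]] : exists (L1 : list (form * (nat -> B))) (lA : list A),
     (forall p, List.In p L1 -> qfree p.1 /\ sat p.2 p.1) /\
     forall p, List.In p L -> (exists b, p.2 = (fun i => inl (b i)) /\ List.In (p.1, b) L1) \/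
       (exists c, p.2 = (fun i => inr (c i)) /\ qfree p.1 /\ sat c p.1) \/
       (exists x, List.In x lA /\ p.2 = link x /\ p.1 = feq (tvar 0) (tvar 1)).
    elim: L HL => [|[F a] L IH] HL; first by exists nil, nil.
    have [|L1 [lA [H1 H2]]] := IH; first by move=> p Hp; apply: HL; right.
    case: (HL (F, a) (or_introl erefl)) => /= [[b [-> [Qb Hb]]]|[[c [-> [Qc Hc]]]|[x [-> ->]]]].
    - exists ((F, b) :: L1)%list, lA; split=> [p [<- //|/H1 //]|p [<-|/H2]]; first by left; exists b; split=> //; left.
      move=> [[b' [e H]]|H]; [left; exists b'; split=> //; by right|by right].
    - exists L1, lA; split=> // p [<-|/H2 //]; by right; left; exists c.
    - exists L1, (x :: lA)%list; split=> // p [<-|/H2]; first by right; right; exists x; split=> //; left.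
      move=> [H|[H|[x' [Hx H]]]]; [by left|by right; left|right; right; exists x'; split=> //; by right].
  have [|F [r [v [QF [Hv [Hv' HF]]]]]] := @finite_diagram B (s_one B) (List.map f lA) L1.
    by move=> p /H1[].
  have vF : sat v F.
    apply/HF => p Hp; apply: (proj1 (eq_sat _)) (H1 p Hp).2 => i /(Hv' _ Hp) //.
  (* Parameters from the image of [A] are pulled back; [js] collects the other variables, which are
     to be quantified. *)
  have Hpre j : exists x, (exists x, f x = v j) -> f x = v j.
    by case: (EM (exists x, f x = v j)) => [[x Hx]|]; [exists x|exists (s_one A)].
  have [a' Ha'] := choice Hpre.
  pose js := seq.filter (fun j => ~~ `[< exists x, f x = v j >]) (fv F).
  have GB : sat (fun i => f (a' i)) (foldr fex F js).
    apply/sat_fexs; exists (fun i => if i \in js then v i else f (a' i)).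
    split=> [i /negbTE-> //|]; apply: (proj1 (eq_sat _)) vF => i Hi.
    rewrite mem_filter Hi andbT; case: asboolP => //= Hx.
    by rewrite Ha'.
  have /sat_fexs[d [Hd dF]] := mc_elem HV Hmc VA TB TC Hf Hg GB.
  exists C; split; first by apply/model_ThV => //; apply: mc_model TC.
  exists (fun x => match x with inl b => d (r b) | inr c => c end) => p /H2[[b [-> Hp]]|[[c [-> []//]]|[x [Hx [-> ->]]]]] /=.
    by have := proj1 (HF C d) dF _ Hp.
  have vx : v (r (f x)) = f x by apply/Hv/List.in_map.
  rewrite Hd; last by rewrite mem_filter negb_and negbK; apply/orP; left; apply/asboolP; exists x.
  congr g; apply: Hf.2; rewrite Ha' //; by exists x.
have VD : V D by apply/(model_ThV D HV).
have E1 : embedding (fun b => v (inl b)).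
  by apply: diagram_embedding => F b QF Hb; apply: (Hv F (fun i => inl (b i))); left; exists b.
have E2 : embedding (fun c => v (inr c)).
  by apply: diagram_embedding => F c QF Hc; apply: (Hv F (fun i => inr (c i))); right; left; exists c.
exists D, (fun b => v (inl (hB b))), (fun c => v (inr (hC c))).
split=> //; split; first exact: (emb_comp HhB E1).
split=> [|x]; first exact: (emb_comp HhC E2).
by apply: (Hv (feq (tvar 0) (tvar 1)) (link x)); right; right; exists x.
Qed.

(** Otherwise compactness yields a tuple in another model of [Ts] with the same literals but without
    [f]. The two tuples generate isomorphic subalgebras, over which models of [Ts] must agree. *)
Lemma mc_local V Ts (N : struct) (a : nat -> N) (P : pred nat) f :
  eq_class V -> model_completion (ThV V) Ts -> model Ts N -> all P (fv f) -> sat a f ->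
  exists sig del : list eqn, eqns_vars_in P sig /\ eqns_vars_in P del /\ lits a (sig, del) /\
    forall N', model Ts N' -> forall a' : nat -> N', lits a' (sig, del) -> sat a' f.
Proof.
move=> HV Hmc TN Pf Hf; apply: contrapT => HN.
pose S g := g = fneg f \/ (exists e, all P (evars e) /\ holds a e /\ g = feqn e) \/
   (exists e, all P (evars e) /\ ~ holds a e /\ g = fneg (feqn e)).
have [L HL|N' [TN' [v Hv]]] := @compactness Ts nat (fun g a => a = id /\ S g).
  have [sig [del [H1 [H2 [H3 H4]]]]] : exists sig del : list eqn, eqns_vars_in P sig /\ eqns_vars_in P del /\
     lits a (sig, del) /\ forall (N' : struct) (b : nat -> N'), lits b (sig, del) -> ~ sat b f ->
       forall p, List.In p L -> sat (fun i => b (p.2 i)) p.1.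
    elim: L HL => [|[g c] L IH] HL; first by exists nil, nil; do 4?split.
    have [|sig [del [H1 [H2 [[H3 H3'] H4]]]]] := IH; first by move=> p Hp; apply: HL; right.
    have [/= -> [->|[[e [Pe [He ->]]]|[e [Pe [He ->]]]]]] := HL (g, c) (or_introl erefl).
    - exists sig, del; split=> //; split=> //; split=> // N' b Hb Hfb p [<- //|]; exact: H4.
    - exists (e :: sig)%list, del; split; first exact/eqns_vars_in_cons.
      split=> //; split; first by split=> //; apply/holds_all_cons.
      move=> N' b [/holds_all_cons[He' Hb] Hb'] Hfb p [<- //|]; exact: H4.
    - exists sig, (e :: del)%list; split=> //; split; first exact/eqns_vars_in_cons.
      split; first by split=> // e' [<- //|]; apply: H3'.
      move=> N' b [Hb Hb'] Hfb p [<-|]; first by apply: Hb'; left.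
      by apply: H4 => //; split=> // e' He'; apply: Hb'; right.
  apply: contrapT => HN'; apply: HN; exists sig, del; split=> //; split=> //; split=> //.
  move=> M TM b Hb; apply: contrapT => Hfb; apply: HN'; exists M; split=> //; exists b.
  exact: H4.
have {}Hv g : S g -> sat v g by move=> Sg; apply: (Hv g id).
have [n Hn] := ltn_bound (fv f).
(* Variables outside [P] are replaced by the unit, so that every term over the first [n] variables
   becomes one over [P]. *)
pose sg i := if P i then tvar i else tone.
pose cut (M : struct) (b : nat -> M) i := if P i then b i else s_one M.
have cutE (M : struct) (b : nat -> M) t : eval b (tsub sg t) = eval (cut M b) t.
  by rewrite eval_tsub; congr eval; apply/funext => i; rewrite /sg /cut; case: (P i).
have Psg t : all P (tvars (tsub sg t)).
  by rewrite tvars_tsub; apply/allP => i _; rewrite /sg; case: (boolP (P i)) => //= ->.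
have [|k [Hk kE]] := @sub_lift_emb N N' n (cut N a) (cut N' v).
  move=> s t _ _; rewrite -!cutE; pose e := (tsub sg s, tsub sg t).
  have Pe : all P (evars e) by rewrite all_cat !Psg.
  split=> [H|H]; first by apply: (Hv (feqn e)); right; left; exists e.
  apply: contrapT => He; apply: (Hv (fneg (feqn e))) => //.
  by right; right; exists e.
have [g Hg] := sub_gens n (cut N a).
apply: (Hv (fneg f)); first by left.
have VM : V (gen_sub n (cut N a)) by apply: class_sub => //; apply: mc_model TN.
have Hgf : sat (fun i => sval (g i)) f.
  apply: (proj1 (eq_sat _)) Hf => i Hi; rewrite Hg; last by move/allP: Hn; apply.
  by rewrite /cut; move/allP: Pf => ->.
have := mc_elem HV Hmc VM TN TN' (sub_emb n (cut N a)) Hk Hgf.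
apply: (proj1 (eq_sat _)) => i Hi; have Hin : i < n by move/allP: Hn; apply.
rewrite (kE (tvar i)) /= ?Hin //; last exact: Hg.
by rewrite /cut; move/allP: Pf => ->.
Qed.

(** The formula [f] says that a tuple is the image of [b] under a homomorphism from [A]. The
    relations sought are the equations [sig] in the description that [mc_local] gives of [f] at
    [b]. *)
Lemma mc_coherent V Ts : eq_class V -> model_completion (ThV V) Ts -> coherent V.
Proof.
move=> HV Hmc A [VA [n [g [R [gg [HR [gR gh]]]]]]] m b.
split; first exact: class_sub.
have [t Ht] := choice (fun i => gg (b i)).
(* Variables below [m] name the elements [b]; the generators of [A] are shifted to the next [n]
   indices. *)
pose sh i := tvar (m + i).
pose R' := List.map (esub sh) R.
pose T' := List.map (fun i => (tvar i, tsub sh (t i))) (iota 0 m).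
pose F := eqns_form (R' ++ T')%list.
pose f := foldr fex F (iota m n).
have Pf : all (fun i => i < m) (fv f).
  have : all (fun i => i < m + n) (fv F).
    apply: fv_eqns_form; apply/eqns_vars_in_app; split.
      by apply: eqns_vars_in_esub HR _ => i Hi; rewrite /= ltn_add2l Hi.
    apply/eqns_vars_inP => e /List.in_map_iff[i [<- /InP]]; rewrite mem_iota /= add0n => Hi.
    rewrite /evars /= ltn_addr //= tvars_tsub; apply: sub_all (Ht i).1 => j Hj.
    by rewrite /= ltn_add2l Hj.
  rewrite /f fv_fexs all_filter; apply: sub_all => i Hi /=.
  by apply/implyP; rewrite mem_iota Hi andbT -ltnNge.
have fE (M : struct) (c : nat -> M) : sat c f <-> exists d : nat -> M,
    holds_all d R /\ forall i, i < m -> c i = eval d (t i).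
  rewrite sat_fexs; split=> [[d [Hd /sat_eqns_form/holds_all_app[/holds_all_esub d1 d2]]]|[d [d1 d2]]].
    exists (fun i => eval d (sh i)); split=> // i Hi.
    rewrite -Hd; last by rewrite mem_iota negb_and -ltnNge Hi.
    have := d2 _ (List.in_map (fun i => (tvar i, tsub sh (t i))) (iota 0 m) i (proj2 (InP _ _) _)).
    by rewrite /holds /= eval_tsub; apply; rewrite mem_iota.
  pose d' i := if i < m then c i else if i < m + n then d (i - m) else c i.
  have d'E u : all (fun i => i < n) (tvars u) -> eval d' (tsub sh u) = eval d u.
    move=> Hu; rewrite eval_tsub; apply: eq_eval Hu _ => i Hi.
    by rewrite /= /d' ltnNge leq_addr /= ltn_add2l Hi addKn.
  exists d'; split.
    by move=> i; rewrite mem_iota /d'; case: (ltnP i m) => //= mi; case: (i < m + n).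
  apply/sat_eqns_form/holds_all_app; split.
    move=> e /List.in_map_iff[e' [<- He']]; move: (HR e' He') => /andP[h1 h2].
    by rewrite /holds /= !d'E //; apply: d1.
  move=> e /List.in_map_iff[i [<- /InP]]; rewrite mem_iota /= add0n => Hi.
  rewrite /holds /= d'E; last exact: (Ht i).1.
  by rewrite /d' Hi; apply: d2.
have [N [TN [h Hh]]] := mc_embed HV Hmc VA.
have Hf : sat (fun i => h (b i)) f.
  apply/fE; exists (fun i => h (g i)); split; first exact: holds_all_hom Hh.1 gR.
  by move=> i Hi; rewrite (Ht i).2 (eval_hom _ _ Hh.1).
have [sig [del [Hs [_ [[H1 H2] H3]]]]] := mc_local HV Hmc TN Pf Hf.
have {}H1 : holds_all b sig by apply/(holds_all_emb b sig Hh).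
have {}H2 e : List.In e del -> ~ holds b e by move=> He /(holds_emb b e Hh); apply: H2.
have [q Hq] := sub_gens m b.
exists m, q, sig; split.
  move=> x; have [u [Hu ->]] := sub_elP x; exists u; split=> //.
  apply: (sub_emb m b).2; rewrite (eval_hom _ _ (sub_emb m b).1) /=.
  by apply: eq_eval Hu _ => i Hi; rewrite Hq.
split=> //; split.
  apply/(holds_all_emb _ _ (sub_emb m b)); apply: eq_holds_all Hs _ H1 => i Hi.
  by rewrite Hq.
have [Z [VZ [v [v1 v2]]]] := @exact_model V nat (fun e a => a = id /\ List.In e sig) HV.
have vs : holds_all v sig by move=> e He; apply: (v1 e id).
have {}v2 e : holds v e -> forall B, V B -> forall d : nat -> B, holds_all d sig -> holds d e.
  by move=> He B VB d Hd; apply: (v2 e id He B VB) => e' a' [-> He']; apply: Hd.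
have [N' [TN' [h' Hh']]] := mc_embed HV Hmc VZ.
(* An equation of [del] true in the exact model of [sig] would follow from [sig] and so hold at [b].
   Hence the negative part holds too, and with it [f]. *)
have : sat (fun i => h' (v i)) f.
  apply: H3 => //; split; first exact/(holds_all_emb v sig Hh').
  move=> e He /(holds_emb v e Hh') Hve; apply: (H2 e He).
  exact: (v2 e Hve A VA).
case/fE => d [d1 d2].
have [p [Hp pE]] := gh N' (mc_model HV Hmc TN') d d1.
have pb i : i < m -> p (b i) = h' (v i).
  move=> Hi; rewrite d2 // (Ht i).2 (eval_hom _ _ Hp).
  by apply: eq_eval (Ht i).1 _ => j Hj; apply: pE.
move=> B VB c Hc.
(* The homomorphism [p] sends [b] to the generic solution of [sig], so every equation true of [b] is
   a consequence of [sig]. *)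
have [|k [Hk kE]] := @sub_lift A B m b c.
  move=> s u Hsv Huv e; apply: (v2 (s, u)) => //; apply/(holds_emb v (s, u) Hh').
  have : p (eval b s) = p (eval b u) by rewrite e.
  rewrite !(eval_hom _ _ Hp) /holds /=.
  by rewrite (eq_eval Hsv pb) (eq_eval Huv pb).
exists k; split=> // i Hi; apply: (kE (tvar i)); rewrite /= ?Hi //; exact: Hq.
Qed.

(** * Principal congruences in the Hamiltonian case *)

Definition spow (A : struct) (x : A) n : A := iter n (s_mul x) (s_one A).
Definition tdist (s t : term) : term := tmeet (tmeet (tldiv s t) (tldiv t s)) tone.
Definition sdist (A : struct) (x y : A) : A :=
  s_meet (s_meet (s_ldiv x y) (s_ldiv y x)) (s_one A).

Lemma eval_tpow (A : struct) (a : nat -> A) t n : eval a (tpow t n) = spow (eval a t) n.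
Proof. by elim: n => //= n ->. Qed.

Lemma tvars_tpow (P : pred nat) t n : all P (tvars t) -> all P (tvars (tpow t n)).
Proof. by move=> Ht; elim: n => //= n IH; rewrite all_cat Ht. Qed.

Section PRL.
Variables (A : struct) (HA : is_prl A).
Local Notation "1" := (s_one A).
Local Notation "x ** y" := (@s_mul A x y) (at level 40, left associativity).
Local Notation "x <=: y" := (@le A x y) (at level 70).

Let mC (x y : A) : s_meet x y = s_meet y x. Proof. by case: HA. Qed.
Let jC (x y : A) : s_join x y = s_join y x. Proof. by case: HA => [_ []]. Qed.
Let mA (x y z : A) : s_meet x (s_meet y z) = s_meet (s_meet x y) z.
Proof. by case: HA => [_ [_ []]]. Qed.
Let jA (x y z : A) : s_join x (s_join y z) = s_join (s_join x y) z.
Proof. by case: HA => [_ [_ [_ []]]]. Qed.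
Let mj (x y : A) : s_meet x (s_join x y) = x.
Proof. by case: HA => [_ [_ [_ [_ []]]]]. Qed.
Let jm (x y : A) : s_join x (s_meet x y) = x.
Proof. by case: HA => [_ [_ [_ [_ [_ []]]]]]. Qed.
Let uA (x y z : A) : x ** (y ** z) = x ** y ** z.
Proof. by case: HA => [_ [_ [_ [_ [_ [_ []]]]]]]. Qed.
Let u1l (x : A) : 1 ** x = x.
Proof. by case: HA => [_ [_ [_ [_ [_ [_ [_ []]]]]]]]. Qed.
Let u1r (x : A) : x ** 1 = x.
Proof. by case: HA => [_ [_ [_ [_ [_ [_ [_ [_ []]]]]]]]]. Qed.
Let res (a b c : A) : (b <=: s_ldiv a c <-> a ** b <=: c) /\ (a ** b <=: c <-> a <=: s_rdiv c b).
Proof. by case: HA => [_ [_ [_ [_ [_ [_ [_ [_ [_ H]]]]]]]]]; apply: H. Qed.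
Let resl a b c : (b <=: s_ldiv a c) <-> (a ** b <=: c) := proj1 (res a b c).
Let resr a b c : (a ** b <=: c) <-> (a <=: s_rdiv c b) := proj2 (res a b c).

Let mm (x : A) : s_meet x x = x.
Proof. by rewrite -{2}(jm x x) mj. Qed.

Lemma prl_le_refl (x : A) : x <=: x. Proof. exact: mm. Qed.
Lemma prl_le_trans (y x z : A) : x <=: y -> y <=: z -> x <=: z.
Proof. by rewrite /le => <- h; rewrite -mA h. Qed.
Lemma prl_le_anti (x y : A) : x <=: y -> y <=: x -> x = y.
Proof. by rewrite /le => h1 h2; rewrite -h1 mC h2. Qed.
Lemma prl_meetl (x y : A) : s_meet x y <=: x.
Proof. by rewrite /le mC mA mm. Qed.
Lemma prl_meetr (x y : A) : s_meet x y <=: y.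
Proof. by rewrite /le -mA mm. Qed.
Lemma prl_meet (x y z : A) : z <=: x -> z <=: y -> z <=: s_meet x y.
Proof. by rewrite /le => h1 h2; rewrite mA h1 h2. Qed.
Lemma prl_joinl (x y : A) : x <=: s_join x y. Proof. exact: mj. Qed.
Lemma prl_joinr (x y : A) : y <=: s_join x y. Proof. by rewrite jC; apply: mj. Qed.
Lemma prl_leE (x y : A) : x <=: y <-> s_join x y = y.
Proof. by split=> [<-|<-]; [rewrite mC jC jm|exact: mj]. Qed.
Lemma prl_join (x y z : A) : x <=: z -> y <=: z -> s_join x y <=: z.
Proof. by rewrite !prl_leE => h1 h2; rewrite -jA h2 h1. Qed.

Lemma prl_mulr (x y z : A) : x <=: y -> z ** x <=: z ** y.
Proof. by move=> h; apply/resl; apply: prl_le_trans h _; apply/resl; apply: prl_le_refl. Qed.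
Lemma prl_mull (x y z : A) : x <=: y -> x ** z <=: y ** z.
Proof. by move=> h; apply/resr; apply: prl_le_trans h _; apply/resr; apply: prl_le_refl. Qed.
Lemma prl_mul (x x' y y' : A) : x <=: x' -> y <=: y' -> x ** y <=: x' ** y'.
Proof. by move=> h1 h2; apply: prl_le_trans (prl_mull y h1) (prl_mulr x' h2). Qed.
Lemma prl_negl (c x : A) : c <=: 1 -> c ** x <=: x.
Proof. by move=> h; have := prl_mull x h; rewrite u1l. Qed.

Lemma spowD (u : A) m n : spow u (m + n) = spow u m ** spow u n.
Proof.
have S k : spow u k.+1 = u ** spow u k by [].
by elim: m => [|m IH]; rewrite ?u1l // addSn !S IH uA.
Qed.
Lemma spowM (u : A) m n : spow (spow u m) n = spow u (n * m).
Proof. by elim: n => // n IH; rewrite mulSn spowD -IH. Qed.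
Lemma spow_neg (u : A) n : u <=: 1 -> spow u n <=: 1.
Proof.
move=> hu; elim: n => [|n IH]; first exact: prl_le_refl.
by have := prl_mul hu IH; rewrite u1l.
Qed.
Lemma spow_anti (u : A) m n : u <=: 1 -> m <= n -> spow u n <=: spow u m.
Proof.
by move=> hu mn; rewrite -(subnK mn) spowD; apply/prl_negl/spow_neg.
Qed.
Lemma spow1 (u : A) : spow u 1%N = u. Proof. exact: u1r. Qed.

(** Inductive step: u(u^m ∨ z) ≤ u^(m+1) ∨ z by residuation, and the left side is u when u^m ∨ z is
    the unit; then u ∨ z lies below as well. *)
Lemma join_pow_one (u z : A) m : u <=: 1 -> z <=: 1 -> s_join u z = 1 -> s_join (spow u m) z = 1.
Proof.
move=> hu hz e; elim: m => [|m IH].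
  by rewrite jC; apply/prl_leE.
apply: prl_le_anti; first by apply: prl_join => //; apply: spow_neg.
set t := s_join _ _; rewrite -e.
have zt : z <=: t by apply: prl_joinr.
apply: prl_join => //.
have : u ** s_join (spow u m) z <=: t.
  apply/resl/prl_join; apply/resl; first exact: prl_joinl.
  exact: prl_le_trans (prl_negl z hu) zt.
by rewrite IH u1r.
Qed.

Lemma sdist_neg (x y : A) : sdist x y <=: 1. Proof. exact: prl_meetr. Qed.

(** Reduces congruences to pairs (d, e) with d ≤ e. If d is congruent to e, then xd ≤ y and yd ≤ x
    make both [x] and [y] congruent to x ∧ y. *)
Lemma sdistP th : congruence th -> forall x y : A, th x y <-> th (sdist x y) 1.
Proof.
move=> Hth; have [r [s [t c]]] := Hth => x y; split=> h.
  have -> : 1 = sdist y y.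
    apply: prl_le_anti (sdist_neg y y); apply: prl_meet; last exact: prl_le_refl.
    by rewrite mm; apply/resl; rewrite u1r; apply: prl_le_refl.
  rewrite /sdist; apply: (c s_meet); auto; apply: (c s_meet); auto; apply: (c s_ldiv); auto 6.
have dl : x ** sdist x y <=: y.
  by apply/resl; apply: prl_le_trans (prl_meetl _ _) _; apply: prl_meetl.
have dr : y ** sdist x y <=: x.
  by apply/resl; apply: prl_le_trans (prl_meetl _ _) _; apply: prl_meetr.
have hx z : th (z ** sdist x y) z.
  by rewrite -{2}(u1r z); apply: (c s_mul); auto.
have mx z z' : z ** sdist x y <=: z' -> th z (s_meet z z').
  move=> hz; apply: (t _ (z ** sdist x y)); first exact/s/hx.
  by rewrite -hz; apply: (c s_meet); auto.
apply: (t _ (s_meet x y)); first exact: mx.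
by apply: s; rewrite mC; apply: mx.
Qed.

Lemma sdist_eq (x y : A) : sdist x y = 1 <-> x = y.
Proof.
apply: iff_sym; apply: (@sdistP eq); split=> //; split=> [//|].
by split=> [x' y' z' -> //|op _ p p' q q' -> ->].
Qed.

Lemma Cg_pow (u v : A) m : v <=: 1 -> spow u m <=: v -> Cg u 1 v 1.
Proof.
move=> hv hm th Hth hu; have [r [s [t c]]] := Hth.
have hp : th (spow u m) 1.
  elim: m {hm} => [|m IH]; first exact: r.
  by rewrite -(u1r 1); apply: (c s_mul); auto.
apply: (t _ (s_meet 1 v)); first by rewrite mC hv; apply: r.
apply: (t _ (spow u m)) => //; rewrite -hm; apply: (c s_meet); auto; exact: s.
Qed.

Section Central.
Variables (w : A) (hw : w <=: 1) (cw : forall y, w ** y = y ** w).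

(** An explicit congruence, against which the abstractly defined [Cg u 1] is tested in [Cg_powE]
    with [w] a central power of [u]. *)
Definition powth (x y : A) := exists m, spow w m ** x <=: y /\ spow w m ** y <=: x.

Let cpow m y : spow w m ** y = y ** spow w m.
Proof.
elim: m => [|m IH]; first by rewrite u1l u1r.
by rewrite -addn1 spowD spow1 -uA cw uA IH uA.
Qed.

Let pow_up m n x y : m <= n -> spow w m ** x <=: y -> spow w n ** x <=: y.
Proof. by move=> mn; apply: prl_le_trans; apply/prl_mull/spow_anti. Qed.

(** The exponent [m + m] leaves one central factor for each argument. For the residuals the
    denominator uses the reverse inequality. *)
Let step op : (op = s_meet \/ op = s_join \/ op = s_mul \/ op = s_ldiv \/ op = s_rdiv) ->
  forall m x x' y y', spow w m ** x <=: x' -> spow w m ** x' <=: x ->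
    spow w m ** y <=: y' -> spow w m ** y' <=: y -> spow w (m + m) ** op x y <=: op x' y'.
Proof.
move=> Hop m x x' y y' h1 h2 h3 h4; have hc := spow_neg m hw; have cc := cpow m.
rewrite spowD; move: (spow w m) hc cc h1 h2 h3 h4 => c hc cc h1 h2 h3 h4.
have ccl z z' : c ** z <=: z' -> c ** c ** z <=: z'.
  by move=> h; rewrite -uA; apply: prl_le_trans (prl_negl _ hc) h.
case: Hop => [->|[->|[->|[->|->]]]].
- by apply: prl_meet; apply: ccl; [apply: prl_le_trans h1|apply: prl_le_trans h3];
    apply: prl_mulr; [apply: prl_meetl|apply: prl_meetr].
- apply/resl/prl_join; apply/resl/ccl; [apply: prl_le_trans h1 _|apply: prl_le_trans h3 _];
    [exact: prl_joinl|exact: prl_joinr].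
- have -> : c ** c ** (x ** y) = c ** x ** (c ** y).
    by rewrite -(uA c c) (uA c x) (cc (c ** x ** y)) -!uA (cc y).
  exact: prl_mul.
- apply/resl; have -> : x' ** (c ** c ** s_ldiv x y) = c ** (c ** x' ** s_ldiv x y).
    by rewrite !uA -(cc x') -(uA c x' c) -(cc x') !uA.
  apply: prl_le_trans h3; apply: prl_mulr.
  by apply: prl_le_trans (prl_mull _ h2) _; apply/resl/prl_le_refl.
- apply: (proj1 (resr _ _ _)); have -> : c ** c ** s_rdiv x y ** y' = c ** (s_rdiv x y ** (c ** y')).
    by rewrite -!uA; congr (c ** _); rewrite !uA cc.
  apply: prl_le_trans h1; apply: prl_mulr.
  by apply: prl_le_trans (prl_mulr _ h4) _; apply/resr/prl_le_refl.
Qed.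

Lemma powth_congruence : congruence powth.
Proof.
split=> [x|]; first by exists 0; rewrite u1l; split; apply: prl_le_refl.
split=> [x y [m [h1 h2]]|]; first by exists m.
split=> [x y z [m [h1 h2]] [n [h3 h4]]|op Hop x x' y y' [m [h1 h2]] [n [h3 h4]]].
  exists (n + m); split; rewrite ?[in X in X <=: _]spowD -uA.
    exact: prl_le_trans (prl_mulr _ h1) h3.
  rewrite uA -spowD addnC spowD -uA.
  exact: prl_le_trans (prl_mulr _ h4) h2.
have l := leq_maxl m n; have r := leq_maxr m n.
exists (maxn m n + maxn m n); split; apply: step => //;
  by [apply: pow_up h1|apply: pow_up h2|apply: pow_up h3|apply: pow_up h4].
Qed.
End Central.

Lemma Cg_powE (u v : A) k : 0 < k -> u <=: 1 -> (forall y, spow u k ** y = y ** spow u k) ->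
  v <=: 1 -> Cg u 1 v 1 <-> exists m, spow u m <=: v.
Proof.
move=> k0 hu hc hv; split=> [H|[m hm]]; last exact: Cg_pow hm.
have hw := spow_neg k hu.
have [|m [_]] := H _ (powth_congruence hw hc).
  (* One factor [spow u k] relates [u] to the unit, because [k] is positive. *)
  exists 1%N; rewrite spow1 u1r; split.
    by have := prl_mul hw hu; rewrite u1l.
  by rewrite -{2}(spow1 u); apply: spow_anti.
by rewrite u1r spowM => h; exists (m * k).
Qed.
End PRL.

Lemma variety_prl V A : variety V -> V A -> is_prl A.
Proof. by move=> [E HE] /HE[]. Qed.

Lemma Cg_negative V : variety V -> hamiltonian V -> forall A, V A -> forall u v : A,
  le u (s_one A) -> le v (s_one A) -> Cg u (s_one A) v (s_one A) <-> exists m, le (spow u m) v.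
Proof.
move=> HV [k [k0 Hk]] A VA u v hu hv.
apply: (Cg_powE (variety_prl HV VA) k0) => // y.
have := Hk A VA (fun i => if i is 0 then u else y).
by rewrite /holds /= !eval_tpow /= hu.
Qed.

Lemma Cg_sdist V : variety V -> forall A, V A -> forall a1 a2 b1 b2 : A,
  Cg b1 b2 a1 a2 <-> Cg (sdist b1 b2) (s_one A) (sdist a1 a2) (s_one A).
Proof.
move=> HV A VA a1 a2 b1 b2; have HA := variety_prl HV VA.
split=> H th Hth h; have S := sdistP HA Hth.
  exact: (proj1 (S a1 a2) (H th Hth (proj2 (S b1 b2) h))).
exact: (proj2 (S a1 a2) (H th Hth (proj1 (S b1 b2) h))).
Qed.

(* In a model of Ts, [v] is not above a power of [u] iff some [z <= 1] satisfies
   [u \/ z = 1] but not [v \/ z = 1]: in [A * A/Cg(u,1)] take [z = (1, v)]. *)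
Lemma mc_bound V Ts : variety V -> hamiltonian V -> model_completion (ThV V) Ts ->
  exists n, forall A, V A -> forall u v : A, le u (s_one A) -> le v (s_one A) ->
    (exists m, le (spow u m) v) -> le (spow u n) v.
Proof.
move=> HV Hh Hmc; have EV := variety_eq_class HV; apply: contrapT => HN.
pose u := tvar 0; pose v := tvar 1; pose z := tvar 2.
pose leq_t s t := feq (tmeet s t) s.
pose core := fand (leq_t z tone) (fand (feq (tjoin u z) tone) (fneg (feq (tjoin v z) tone))).
pose psi := fex 2 core.
(* The type of a pair of negative elements with no power of [u] below [v] and yet no separating [z].
   Were there no bound, it would be finitely satisfiable in models of [Ts]. *)
pose S f := f = fneg psi \/ f = leq_t u tone \/ f = leq_t v tone \/ exists n, f = fneg (leq_t (tpow u n) v).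
have [L HL|N [TN [a Ha]]] := @compactness Ts nat (fun f a => a = id /\ S f).
  have [M HM] : exists M, forall p, List.In p L -> p.2 = id /\
      (p.1 = fneg psi \/ p.1 = leq_t u tone \/ p.1 = leq_t v tone \/
       exists n, n <= M /\ p.1 = fneg (leq_t (tpow u n) v)).
    elim: L HL => [|p L IH] HL; first by exists 0.
    have [|M HM] := IH; first by move=> q Hq; apply: HL; right.
    have [e Hp] := HL p (or_introl erefl).
    have [n Hn] : exists n, p.1 = fneg psi \/ p.1 = leq_t u tone \/ p.1 = leq_t v tone \/
       p.1 = fneg (leq_t (tpow u n) v).
      by case: Hp => [H|[H|[H|[n H]]]]; [exists 0|exists 0|exists 0|exists n]; auto.
    exists (maxn n M) => q [<-|/HM[e' Hq]]; split=> //.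
      case: Hn => [H|[H|[H|H]]]; auto; right; right; right; exists n; by rewrite leq_maxl.
    case: Hq => [H|[H|[H|[n' [Hn' H]]]]]; auto; right; right; right; exists n'.
    by rewrite leq_max Hn' orbT.
  apply: contrapT => HN'; apply: HN; exists M => A VA x y hx hy [m hm].
  apply: contrapT => hM; apply: HN'.
  have [N [TN [h Hh']]] := mc_embed EV Hmc VA.
  have VN := mc_model EV Hmc TN; have PN := variety_prl HV VN.
  have [[h1 [h2 [h3 [h4 [h5 [h6 h7]]]]]] hi] := Hh'.
  have hpow n : h (spow x n) = spow (h x) n by elim: n => //= n <-; rewrite h3.
  have leh p q : le p q <-> le (h p) (h q).
    by rewrite /le -h1; split=> [->|/hi].
  exists N; split=> //; exists (fun i => if i is 0 then h x else h y) => p /HM[-> ].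
  case=> [->|[->|[->|[n [nM ->]]]]] /=; rewrite ?eval_tpow /= -?h6.
  (* Here some power of [u] is below [v], so by [join_pow_one] any [z] joining with [u] to the unit
     does so with [v]: there is no separating element. *)
  - move=> [t]; rewrite /upd /= => -[c1 [c2 c3]]; apply: c3.
    have lm : le (spow (h x) m) (h y) by rewrite -hpow; apply/leh.
    have hx' : le (h x) (s_one N) by rewrite -h6; apply/leh.
    have hy' : le (h y) (s_one N) by rewrite -h6; apply/leh.
    rewrite h6 in c1 c2 *.
    have e := join_pow_one PN m hx' c1 c2.
    apply: (prl_le_anti PN); first exact: (prl_join PN).
    rewrite -[X in le X _]e; apply: (prl_join PN); last exact: (prl_joinr PN).
    exact: (prl_le_trans PN lm (prl_joinl PN _ _)).
  - exact/leh.
  - exact/leh.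
  - rewrite -hpow => /leh hn; apply: hM.
    apply: (prl_le_trans (variety_prl HV VA)) hn.
    exact: (spow_anti (variety_prl HV VA)).
have {}Ha f : S f -> sat a f by move=> Sf; apply: (Ha f id).
have VN := mc_model EV Hmc TN; have PN := variety_prl HV VN.
pose x := a 0; pose y := a 1%N.
have hx : le x (s_one N) by apply: (Ha (leq_t u tone)); right; left.
have hy : le y (s_one N) by apply: (Ha (leq_t v tone)); right; right; left.
have hn n : ~ le (spow x n) y.
  have /= := Ha (fneg (leq_t (tpow u n) v)); rewrite eval_tpow; apply.
  by right; right; right; exists n.
pose th := Cg x (s_one N); have Hth : congruence th := Cg_congruence x (s_one N).
pose C (b : bool) := if b then N else quot Hth.
pose l (b : bool) : N -> C b := match b with true => id | false => qcl Hth end.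
have Hl b : is_hom (l b) by case: b => //; apply: qcl_hom.
pose i (t : N) : prod_struct C := fun b => l b t.
have Hi : embedding i by apply: (@pairing_emb bool C N l true).
pose zz : prod_struct C := fun b => match b return C b with true => s_one N | false => qcl Hth y end.
have VP : V (prod_struct C) by apply: class_prod => // -[] //; apply: class_quot.
have [N' [TN' [k Hk]]] := mc_embed EV Hmc VP.
have Hpsi : sat (fun j => i (a j)) psi.
  exists zz; rewrite /core /= /upd /=.
  have J := prl_leE PN.
  have q := qcl_hom Hth; have [q1 [q2 [q3 [q4 [q5 [q6 q7]]]]]] := q.
  have E1 : s_meet (qcl Hth y) (qcl Hth (s_one N)) = qcl Hth y by rewrite -q1 hy.
  have E2 : s_join (qcl Hth x) (qcl Hth y) = qcl Hth (s_one N).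
    have -> : qcl Hth x = qcl Hth (s_one N) by apply/qclE; apply: Cg_gen.
    rewrite -q2; congr (qcl Hth _); apply: (prl_le_anti PN).
      by apply: (prl_join PN) => //; apply: (prl_le_refl PN).
    exact: (prl_joinl PN).
  have E3 : s_join (qcl Hth y) (qcl Hth y) = qcl Hth y.
    by rewrite -q2 (proj1 (J y y) (prl_le_refl PN y)).
  split; last split.
  - apply: functional_extensionality_dep => -[]; [exact: (prl_le_refl PN)|exact: E1].
  - apply: functional_extensionality_dep => -[]; [exact: (proj1 (J x _) hx)|exact: E2].
  - move=> /(f_equal (fun t : prod_struct C => t false)) E4.
    have /qclE : qcl Hth y = qcl Hth (s_one N) by rewrite -[LHS]E3; exact: E4.
    by move/(Cg_negative HV Hh VN hx hy) => [n /hn].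
have Hpsi' : sat (fun j => k (i (a j))) psi.
  case: Hpsi => t Ht; exists (k t); rewrite (upd_comp k).
  exact/(sat_qf_emb _ Hk).
(* The separating element found outside [N] yields one inside, as [psi] has parameters in [N] and
   both [N'] and [N] are models of [Ts] containing it. *)
have := mc_elem EV Hmc VN TN' TN (emb_comp Hi Hk) (id_emb N) Hpsi'.
by apply: (Ha (fneg psi)); left.
Qed.

(** Once the exponent is uniform, membership in a principal congruence becomes a single inequality
    between distance terms. *)
Lemma mc_EDPC V Ts : variety V -> hamiltonian V -> model_completion (ThV V) Ts -> EDPC V.
Proof.
move=> HV Hh Hmc; have [n Hn] := mc_bound HV Hh Hmc.
pose d := tdist (tvar 0) (tvar 1); pose d' := tdist (tvar 2) (tvar 3).
exists ((tmeet (tpow d' n) d, tpow d' n) :: nil)%list; split.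
  apply/eqns_vars_inP => e [<-|//].
  have H : all (fun i => i < 4) (tvars (tpow d' n)) by apply: tvars_tpow.
  by rewrite !all_cat H.
move=> A VA a1 a2 b1 b2; have HA := variety_prl HV VA.
rewrite (Cg_sdist HV VA) (Cg_negative HV Hh VA) //; [|exact: sdist_neg|exact: sdist_neg].
split=> [H e [<-|//]|H].
  rewrite /holds /= eval_tpow; apply: Hn => //; exact: sdist_neg.
exists n; have := H _ (or_introl erefl); by rewrite /holds /= eval_tpow.
Qed.

(** * Joining systems of equations, and the variable restriction property *)

Definition teqns (E : list eqn) : term :=
  List.fold_right (fun e t => tmeet (tdist e.1 e.2) t) tone E.

Lemma teqns_neg (A : struct) (a : nat -> A) E : is_prl A -> le (eval a (teqns E)) (s_one A).
Proof.
move=> HA; elim: E => [|e E IH] /=; first exact: (prl_le_refl HA).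
exact: (prl_le_trans HA (prl_meetr HA _ _) IH).
Qed.

Lemma teqnsP (A : struct) (a : nat -> A) E : is_prl A ->
  eval a (teqns E) = s_one A <-> holds_all a E.
Proof.
move=> HA; elim: E => [|e E IH] /=; first by split=> // _ e [].
rewrite holds_all_cons -IH /holds -(sdist_eq HA (eval a e.1)) -/(sdist (eval a e.1) (eval a e.2)).
split=> [h|[-> ->]]; last exact: (prl_le_refl HA).
split; apply: (prl_le_anti HA); [exact: sdist_neg| |exact: teqns_neg|]; rewrite -{1}h.
  exact: (prl_meetl HA).
exact: (prl_meetr HA).
Qed.

Lemma tvars_teqns (P : pred nat) E : eqns_vars_in P E -> all P (tvars (teqns E)).
Proof.
elim: E => //= e E IH /eqns_vars_in_cons[]; rewrite !all_cat => /andP[-> ->] /IH ->.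
by [].
Qed.

(** A system implies [gam] only if, in each algebra, some power of its term lies below the term of
    [gam]. Two uses of [join_pow_one] pass from the join of the two terms to the join of such
    powers. *)
Lemma consequence_join V (P : pred nat) gam s t : variety V -> hamiltonian V ->
  eqns_vars_in P s -> eqns_vars_in P t ->
  (forall A, V A -> forall a : nat -> A, holds_all a s -> holds_all a gam) ->
  (forall A, V A -> forall a : nat -> A, holds_all a t -> holds_all a gam) ->
  exists E, eqns_vars_in P E /\
    forall A, V A -> forall a : nat -> A, (holds_all a s \/ holds_all a t -> holds_all a E) /\
      (holds_all a E -> holds_all a gam).
Proof.
move=> HV Hh Ps Pt Hs Ht; exists ((tjoin (teqns s) (teqns t), tone) :: nil)%list; split.
  apply/eqns_vars_inP => e [<-|//]; by rewrite /evars /= cats0 all_cat !tvars_teqns.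
move=> A VA a; have HA := variety_prl HV VA; have EV := variety_eq_class HV; split.
  move=> H e [<-|//]; rewrite /holds /=.
  case: H => [/(teqnsP a s HA) ->|/(teqnsP a t HA) ->]; apply: (prl_le_anti HA).
  - by apply: (prl_join HA); [apply: (prl_le_refl HA)|apply: teqns_neg].
  - exact: (prl_joinl HA).
  - by apply: (prl_join HA); [apply: teqns_neg|apply: (prl_le_refl HA)].
  - exact: (prl_joinr HA).
move=> H; have {}H : s_join (eval a (teqns s)) (eval a (teqns t)) = s_one A := H _ (or_introl erefl).
have pow r : (forall A, V A -> forall a : nat -> A, holds_all a r -> holds_all a gam) ->
    exists m, le (spow (eval a (teqns r)) m) (eval a (teqns gam)).
  move=> Hr; apply/(Cg_negative HV Hh VA); [exact: teqns_neg|exact: teqns_neg|] => th Hth h.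
  have VQ := class_quot Hth EV VA; have PQ := variety_prl HV VQ.
  have hom := qcl_hom Hth; have q1 : qcl Hth (s_one A) = s_one (quot Hth) by [].
  apply/(qclE Hth); rewrite q1 (eval_hom _ _ hom); apply/(teqnsP _ _ PQ)/Hr => //.
  by apply/(teqnsP _ _ PQ); rewrite -(eval_hom _ _ hom) -q1; apply/qclE.
have [m hm] := pow s Hs; have [n hn] := pow t Ht.
have hs := teqns_neg a s HA; have ht := teqns_neg a t HA.
have e1 := join_pow_one HA m hs ht H.
have jC : forall p q : A, s_join p q = s_join q p by case: HA => _ [].
rewrite jC in e1; have := join_pow_one HA n ht (spow_neg HA m hs) e1 => e2.
apply/(teqnsP a gam HA); apply: (prl_le_anti HA); first exact: teqns_neg.
by rewrite -e2; apply: (prl_join HA).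
Qed.

(** In models of [Ts] the condition that [gam] holds for all [y] is covered by finitely many systems
    implying [gam]; their successive joins give [pi]. *)
Lemma mc_ERVP V Ts : variety V -> hamiltonian V -> model_completion (ThV V) Ts -> ERVP V.
Proof.
move=> HV Hh Hmc xs y gam yxs Hgam; have EV := variety_eq_class HV.
pose P i := i \in xs.
pose K s := eqns_vars_in P s /\ forall A, V A -> forall a : nat -> A, holds_all a s -> holds_all a gam.
pose f := fall y (eqns_form gam).
have Pf : all P (fv f).
  rewrite /= all_filter; apply: sub_all (fv_eqns_form Hgam) => i.
  by rewrite inE => /orP[/eqP->|Hi]; rewrite ?eqxx //=; apply/implyP.
have Sf (N : struct) (a : nat -> N) : sat a f <-> forall x, holds_all (upd a y x) gam.
  by split=> H x; apply/sat_eqns_form; apply: H.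
have exact s : exists Z, V Z /\ exists v : nat -> Z, holds_all v s /\
    forall E, holds_all v E -> forall B, V B -> forall b : nat -> B, holds_all b s -> holds_all b E.
  have [Z [VZ [v [v1 v2]]]] := @exact_model V nat (fun e a => a = id /\ List.In e s) EV.
  exists Z; split=> //; exists v; split=> [e He|E HE B VB b Hb e He]; first exact: (v1 e id).
  by apply: (v2 e id (HE e He) B VB) => e' a' [-> He']; apply: Hb.
have [ls [Hls Hcov]] : exists ls, (forall s, List.In s ls -> K s) /\
    forall N, model Ts N -> forall a : nat -> N, sat a f -> exists s, List.In s ls /\ holds_all a s.
  apply: contrapT => HN.
  have [L HL|N [TN [v Hv]]] := @compactness Ts nat (fun g a => a = id /\
      (g = f \/ exists s, K s /\ g = fneg (eqns_form s))).
    have [ls [H1 H2]] : exists ls, (forall s, List.In s ls -> K s) /\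
       forall p, List.In p L -> p.2 = id /\ (p.1 = f \/ exists s, List.In s ls /\ p.1 = fneg (eqns_form s)).
      elim: L HL => [|p L IH] HL; first by exists nil.
      have [|ls [H1 H2]] := IH; first by move=> q Hq; apply: HL; right.
      have [e [Hp|[s [Ks Hp]]]] := HL p (or_introl erefl).
        by exists ls; split=> // q [<-|/H2 //]; split=> //; left.
      exists (s :: ls)%list; split=> [t [<- //|/H1 //]|q [<-|/H2[e' [Hq|[t [Ht Hq]]]]]]; split=> //.
      - by right; exists s; split=> //; left.
      - by left.
      - by right; exists t; split=> //; right.
    apply: contrapT => HN'; apply: HN; exists ls; split=> // N TN a Ha; apply: contrapT => Hs.
    apply: HN'; exists N; split=> //; exists a => p /H2[-> [->|[s [Hs' ->]]]] //=.
    by move/sat_eqns_form => Has; apply: Hs; exists s.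
  have fv' : sat v f by apply: (Hv f id); split=> //; left.
  have [sig [del [Ps [_ [[H1 H2] H3]]]]] := mc_local EV Hmc TN Pf fv'.
  have : sat v (fneg (eqns_form sig)).
    apply: (Hv _ id); split=> //; right; exists sig; split=> //; split=> //.
    (* The positive part [sig] alone implies [gam]: its exact model satisfies no equation of [del],
       so [f] holds there, and instantiating [y] by its own value gives [gam]. *)
    have [Z [VZ [c [cs cE]]]] := exact sig.
    have [N' [TN' [h Hh']]] := mc_embed EV Hmc VZ.
    have : sat (fun i => h (c i)) f.
      apply: H3 => //; split; first exact/(holds_all_emb c sig Hh').
      move=> e He /(holds_emb c e Hh') Hce; apply: (H2 e He).
      have := cE (e :: nil)%list _ N (mc_model EV Hmc TN) v H1; apply; last by left.
      by move=> e' [<-|].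
    move=> /Sf/(_ (h (c y))); rewrite upd_same => /(holds_all_emb c gam Hh'); exact: cE.
  by apply; apply/sat_eqns_form.
(* An empty cover gives [None], which stands for falsity. *)
have [pi [Hpi1 Hpi2]] : exists pi : option (list eqn), (forall E, pi = Some E -> K E) /\
    forall s, List.In s ls -> forall A, V A -> forall a : nat -> A, holds_all a s -> holds_opt a pi.
  elim: ls Hls {Hcov} => [|s ls IH] Hls; first by exists None.
  have [|pi [H1 H2]] := IH; first by move=> t Ht; apply: Hls; right.
  have Ks : K s by apply: Hls; left.
  case: pi H1 H2 => [E|] H1 H2; last first.
    exists (Some s); split=> [E [<-] //|t [<- //|Ht] A VA a Hat].
    by case: (H2 t Ht A VA a Hat).
  have KE := H1 E erefl.
  have [F [PF HF]] := consequence_join HV Hh KE.1 Ks.1 KE.2 Ks.2.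
  exists (Some F); split=> [F' [<-]|t Ht A VA a Hat].
    by split=> // A VA a; apply: (HF A VA a).2.
  apply: (HF A VA a).1; case: Ht Hat => [<-|Ht Hat]; first by right.
  by left; apply: H2 Ht A VA a Hat.
exists pi; split; first by move=> E /Hpi1[].
split=> [A VA a|phi Pphi Hphi A VA a Ha].
  by case: (pi) Hpi1 => //= E /(_ E erefl)[_ H]; apply: H.
(* In a model of [Ts] above the exact model of [phi], [gam] holds for every [y]. Some covering
   system therefore holds at the generic solution, so [pi] holds there too and is a consequence of
   [phi]. *)
have [Z [VZ [c [cs cE]]]] := exact phi.
have [N [TN [h Hh']]] := mc_embed EV Hmc VZ.
have : sat (fun i => h (c i)) f.
  apply/Sf => x; apply: Hphi; first exact: mc_model TN.
  move/(holds_all_emb c phi Hh'): cs; apply: eq_holds_all Pphi _ => i Hi.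
  by rewrite upd_id //; apply: contraNneq yxs => <-.
case/(Hcov N TN) => s [Hs /(holds_all_emb c s Hh') Hc].
have := Hpi2 s Hs Z VZ c Hc; case: (pi) => //= E HE.
exact: (cE E HE A VA a Ha).
Qed.

Theorem theorem6p6 (V : struct -> Prop) :
  variety V -> hamiltonian V ->
  (has_model_completion (ThV V) <-> coherent V /\ EDPC V /\ AP V /\ ERVP V).
Proof.
move=> HV Hh; have EV := variety_eq_class HV; split.
  move=> [Ts Hmc]; split; first exact: mc_coherent Hmc.
  split; first exact: mc_EDPC Hmc.
  by split; [apply: mc_AP Hmc|apply: mc_ERVP Hmc].
move=> [HC [HE [HAP HR]]]; exists (completion V).
exact: completion_is_model_completion.
Qed.
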